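(* Consider jigsaw percolation with $\tau=1$, $\theta=\infty$ and arbitrary $\sigma\ge1$, on a sequence of finite connected puzzle graphs $G_{\mathrm{puz}}$ with number of vertices $N\to\infty$, whose maximum degree is bounded by a constant $D$ independent of $N$. Then there are constants $c_1,c_2>0$, independent of $\sigma$ and $N$ (they may depend on $D$), such that for every $\sigma\ge1$ there is $N_0(\sigma)$ such that for all $N\ge N_0(\sigma)$, $$c_1\frac{\sigma^2}{\log N}\le p_c\le c_2\frac{\sigma^2}{\log N}.$$
   Context: Setting. $G_{\mathrm{puz}}=(V,E_{\mathrm{puz}})$ (the puzzle graph) is a finite connected deterministic graph with $N=|V|$ vertices. $G_{\mathrm{ppl}}=(V,E_{\mathrm{ppl}})$ (the people graph) is the Erdős–Rényi random graph on the same vertex set: each unordered pair of distinct vertices is an edge independently with probability $p$ (which may depend on $N$); $\mathbb{P}_p$ denotes its law. Two vertices $v_1,v_2$ are doubly connected if $\{v_1,v_2\}\in E_{\mathrm{ppl}}\cap E_{\mathrm{puz}}$. For $v\in V$, $S\subset V$, let $\mathrm{coll}(v,S)$ (resp. $\mathrm{link}(v,S)$) be the number of $G_{\mathrm{ppl}}$-neighbors (resp. $G_{\mathrm{puz}}$-neighbors) of $v$ in $S$, not including $v$. Jigsaw percolation with integer parameters $\sigma\ge1$, $\tau\ge1$, $\theta\ge\tau$ ($\theta=\infty$ allowed) is the following discrete-time dynamics on partitions $\mathcal{P}^t=\{W_i^t\}$ of $V$. Given $\mathcal{P}^t$, let $\mathcal{G}_t$ be the graph with vertex set $\mathcal{P}^t$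 and unoriented edges between distinct $W_i^t$ and $W_j^t$ such that, for some ordering of the two, at least one of the following holds: (J1) there are doubly connected $v_1\in W_i^t$, $v_2\in W_j^t$; (J2) there is $v_1\in W_i^t$ with $\mathrm{link}(v_1,W_j^t)\ge\theta$; (J3) there is $v_1\in W_i^t$ with $\mathrm{coll}(v_1,W_j^t)\ge\sigma$ and $\mathrm{link}(v_1,W_j^t)\ge\tau$. Then $\mathcal{P}^{t+1}$ is obtained by merging all sets of $\mathcal{P}^t$ that lie in the same connected component of $\mathcal{G}_t$. $\mathrm{Solve}$ is the event that, starting from $\mathcal{P}^0$ consisting of all singletons, $\mathcal{P}^t=\{V\}$ for some $t$. The critical probability $p_c=p_c(N)$ is defined by $\mathbb{P}_{p_c}(\mathrm{Solve})=\tfrac12$. *)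

(* Defs.v *)
From HB Require Import structures.
From mathcomp Require Import all_boot all_order all_algebra.
From mathcomp Require Import boolp reals exp.

Set Implicit Arguments.
Unset Strict Implicit.
Unset Printing Implicit Defensive.

Import Order.TTheory GRing.Theory Num.Theory.

Record sgraph := SGraph {
  vertex :> finType;
  adj : rel vertex;
  adj_sym : symmetric adj;
  adj_irr : irreflexive adj }.

Definition connected_graph (G : sgraph) : Prop :=
  forall v w : G, connect (@adj G) v w.

Definition max_degree (G : sgraph) : nat :=
  \max_(v : G) #|[set w : G | adj v w]|.

Section Jigsaw.
Variable T : finType.
Variables puz ppl : rel T.

Definition nbr_count (e : rel T) (v : T) (S : {set T}) : nat :=
  #|[set w in S :\ v | e v w]|.

Definition link (v : T) (S : {set T}) : nat := nbr_count puz v S.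
Definition coll (v : T) (S : {set T}) : nat := nbr_count ppl v S.

Variables sigma tau : nat.
(* [None] stands for theta = infinity, in which case J2 never applies. *)
Variable theta : option nat.

Definition J1 (W1 W2 : {set T}) : bool :=
  [exists v1 in W1, exists v2 in W2, ppl v1 v2 && puz v1 v2].

Definition J2 (W1 W2 : {set T}) : bool :=
  if theta is Some th then [exists v1 in W1, th <= link v1 W2] else false.

Definition J3 (W1 W2 : {set T}) : bool :=
  [exists v1 in W1, (sigma <= coll v1 W2) && (tau <= link v1 W2)].

Definition jigsaw (W1 W2 : {set T}) : bool :=
  [|| J1 W1 W2, J2 W1 W2 | J3 W1 W2].

Definition merge_graph (P : {set {set T}}) : rel {set T} :=
  fun W1 W2 => [&& W1 \in P, W2 \in P, W1 != W2 &
                   jigsaw W1 W2 || jigsaw W2 W1].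

Definition jigsaw_step (P : {set {set T}}) : {set {set T}} :=
  [set cover [set W' in P | connect (merge_graph P) W W'] | W in P].

Definition singletons : {set {set T}} := [set [set v] | v : T].

Definition Solve : Prop :=
  exists t : nat, iter t jigsaw_step singletons = [set [set: T]].

End Jigsaw.

Section ErdosRenyi.
Variables (R : realType) (T : finType).
Local Open Scope ring_scope.

Definition vpairs : {set {set T}} := [set e : {set T} | #|e| == 2%N].

Definition edge_rel (E : {set {set T}}) : rel T :=
  fun v w => [set v; w] \in E.

(* The sample space is the set of all E \subset vpairs; the product weight
   makes the events e \in E independent, each of probability p. *)
Definition er_prob (p : R) (A : {set {set T}} -> Prop) : R :=
  \sum_(E : {set {set T}} | (E \subset vpairs) && `[< A E >])
    \prod_(e in vpairs) (if e \in E then p else 1 - p).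

End ErdosRenyi.

Section CriticalProbability.
Variables (R : realType) (G : sgraph) (sigma tau : nat) (theta : option nat).
Local Open Scope ring_scope.

Definition solve_prob (p : R) : R :=
  er_prob p (fun E : {set {set G}} =>
    Solve (@adj G) (edge_rel E) sigma tau theta).

Definition is_critical (p : R) : Prop :=
  0 <= p <= 1 /\ solve_prob p = 2^-1.

End CriticalProbability.

(* Main.v *)
(** Write x = ln N.

    Small p. Every cluster is traversed by a closed puzzle walk, and merging
    clusters two at a time at most doubles their size, so a solved puzzle
    contains an internally spanned set S with 2h < |S| <= 4h, where
    h ~ x / sigma. Each of the |S| - 1 merges inside S consumed either a double
    edge or sigma people edges, so S carries at least h double edges or at
    least sigma h people edges. There are at most N (D+1)^(8h) candidate walks,
    and for p <= c sigma^2 / x a union bound gives P(Solve) <= 2 / N.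

    Large p. Pack disjoint puzzle trees of m sigma vertices, m ~ x^2, ordered so
    that each vertex has an earlier puzzle neighbour; there are N / polylog N of
    them. A tree is solved internally if its i-th vertex is joined, for each
    j < min(i, sigma), to an earlier vertex of index j mod sigma. These events
    involve disjoint sets of pairs, so their joint probability is at least
    (p prod_(g >= 1) (1 - (1-p)^g))^(sigma^2) >= (p e^(-4/p))^(sigma^2), which is
    N^(-1/4-o(1)) once p >= 16 sigma^2 / x. Hence some tree is solved, and every
    outside vertex has sigma collaborators in it. *)

From HB Require Import structures.
From mathcomp Require Import boolp classical_sets reals topology sequences exp.
From mathcomp Require Import all_boot all_order all_algebra.
From mathcomp Require Import ring lra zify.
Require Import Defs.

Set Implicit Arguments.
Unset Strict Implicit.
Unset Printing Implicit Defensive.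

Import Order.TTheory GRing.Theory Num.Theory.

(** * Product Bernoulli measure *)

Section BernoulliExpectation.
Local Open Scope ring_scope.
Variables (R : realFieldType) (I : finType) (p : R).
Implicit Types (s : seq I) (f g : {set I} -> R) (X Y E : {set I}).

(** Expectation of [f] over the random subset of a duplicate-free [s] that keeps each element
    independently with probability [p]. Revealing one element at a time turns linearity,
    monotonicity and independence into inductions on [s]. *)
Fixpoint bexp s f : R :=
  if s is e :: s' then
    p * bexp s' (fun E => f (e |: E)) + (1 - p) * bexp s' f
  else f set0.

Lemma bexp_sumE s f : uniq s ->
  bexp s f = \sum_(E : {set I} | E \subset [set x in s])
               (\prod_(e <- s) (if e \in E then p else 1 - p)) * f E.
Proof.
elim: s f => [|e s IHs] f /=.
  move=> _; rewrite (big_pred1 set0) ?big_nil ?mul1r // => E.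
  have -> : [set x in [::]] = set0 :> {set I} by apply/setP=> x; rewrite !inE.
  by rewrite subset0.
case/andP=> es us; rewrite !IHs // !big_distrr /= [RHS](bigID (fun E : {set I} => e \in E)) /=.
have nothere (E : {set I}) : E \subset [set x in s] -> e \notin E.
  by move=> /subsetP sE; apply: contra es => eE; have := sE _ eE; rewrite inE.
have eqs (E E' : {set I}) : E :\ e = E' :\ e ->
    \prod_(x <- s) (if x \in E then p else 1 - p) =
    \prod_(x <- s) (if x \in E' then p else 1 - p).
  move=> /setP EE; apply: eq_big_seq => x xs; move: (EE x); rewrite !inE.
  have -> : x != e by apply: contraNneq es => <-.
  by move=> /= ->.
congr (_ + _).
  rewrite [RHS](reindex_onto (fun E => e |: E) (fun E => E :\ e)) /=; last first.
    by move=> E /andP[_ eE]; rewrite setD1K.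
  apply: eq_big => E.
    rewrite setU11 andbT; apply/idP/andP.
      move=> sE; split; last by rewrite setU1K // nothere.
      apply/subsetP=> x /setU1P[->|xE]; rewrite !inE ?eqxx //.
      by move/subsetP: sE => /(_ x xE); rewrite inE => ->; rewrite orbT.
    move=> [/subsetP sE /eqP EE]; apply/subsetP=> x xE.
    have := sE x; rewrite !inE xE orbT => /(_ isT) /orP[/eqP xe|//].
    by move: xE; rewrite -EE xe setD11.
  move=> sE; rewrite big_cons setU11 mulrA; congr (_ * _ * _).
  by apply: eqs; rewrite setU1K ?nothere //; apply/setP=> x;
     rewrite !inE; case: eqVneq => // ->; rewrite (negPf (nothere _ sE)).
apply: eq_big => E.
  apply/idP/andP => [sE|[/subsetP sE eE]].
    split; last exact: nothere.
    by apply: subset_trans sE _; apply/subsetP=> x; rewrite !inE orbC => ->.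
  apply/subsetP=> x xE; have := sE x xE; rewrite !inE => /orP[/eqP xe|//].
  by rewrite -xe xE in eE.
by move=> sE; rewrite big_cons (negPf (nothere _ sE)) mulrA.
Qed.

Lemma eq_bexp s f g : f =1 g -> bexp s f = bexp s g.
Proof. by elim: s f g => //= e s IHs f g fg; congr (_ * _ + _ * _); apply: IHs. Qed.

Lemma bexp_const s (c : R) : bexp s (fun=> c) = c.
Proof. by elim: s => //= e s ->; ring. Qed.

Lemma bexpD s f g : bexp s (fun E => f E + g E) = bexp s f + bexp s g.
Proof. by elim: s f g => //= e s IHs f g; rewrite !IHs; ring. Qed.

Lemma bexpB s f g : bexp s (fun E => f E - g E) = bexp s f - bexp s g.
Proof. by elim: s f g => //= e s IHs f g; rewrite !IHs; ring. Qed.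

Lemma bexp_sum s (J : Type) (r : seq J) (F : J -> {set I} -> R) :
  bexp s (fun E => \sum_(j <- r) F j E) = \sum_(j <- r) bexp s (F j).
Proof.
elim: r => [|j r IHr].
  by rewrite big_nil -[RHS](bexp_const s 0); apply: eq_bexp => E; rewrite big_nil.
by rewrite big_cons -IHr -bexpD; apply: eq_bexp => E; rewrite big_cons.
Qed.

(** [f E] depends only on the trace of [E] on [X]. Insertions suffice to express this, and they are
    the only operation that [bexp] performs on [E]. *)
Definition indep_off X f := forall e E, e \notin X -> f (e |: E) = f E.

Lemma indep_offS X Y f : X \subset Y -> indep_off X f -> indep_off Y f.
Proof. by move=> /subsetP XY fX e E eY; apply: fX; apply: contra eY; apply: XY. Qed.

Lemma indep_off_add X f e :
  indep_off X f -> indep_off X (fun E => f (e |: E)).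
Proof. by move=> fX e' E e'X; rewrite setUCA fX. Qed.

(** By disjointness the head of [s] lies outside [X] or outside [Y]. One of the two factors is then
    the same in both branches of the recursion and can be pulled out. *)
Lemma bexp_indep s X Y f g : indep_off X f -> indep_off Y g ->
  [disjoint X & Y] ->
  bexp s (fun E => f E * g E) = bexp s f * bexp s g.
Proof.
move=> fX gY dXY; elim: s f g fX gY => //= e s IHs f g fX gY.
case: (boolP (e \in X)) => eX.
  have eY : e \notin Y by rewrite (disjointFr dXY).
  have ge E : g (e |: E) = g E by apply: gY.
  rewrite (eq_bexp s (g := fun E => f (e |: E) * g E)); last by move=> E; rewrite ge.
  by rewrite (eq_bexp s ge) !IHs //; [ring|apply: indep_off_add].
have fe E : f (e |: E) = f E by apply: fX.
rewrite (eq_bexp s (g := fun E => f E * g (e |: E))); last by move=> E; rewrite fe.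
by rewrite (eq_bexp s fe) !IHs //; [ring|apply: indep_off_add].
Qed.

Lemma indep_off_prod (J : Type) (r : seq J) (F : J -> {set I} -> R) X :
  (forall j, indep_off X (F j)) ->
  indep_off X (fun E => \prod_(j <- r) F j E).
Proof. by move=> FX e E eX; apply: eq_bigr => j _; apply: FX. Qed.

Lemma in_bigcup_seq (J : Type) (r : seq J) (X : J -> {set I}) e :
  (e \in \bigcup_(j <- r) X j) = has (fun j => e \in X j) r.
Proof.
by elim: r => [|j r IHr]; rewrite ?big_nil ?big_cons ?inE //= IHr.
Qed.

Lemma bexp_prod s (J : eqType) (r : seq J) (X : J -> {set I})
    (F : J -> {set I} -> R) :
  uniq r ->
  {in r, forall j, indep_off (X j) (F j)} ->
  {in r &, forall i j, i != j -> [disjoint X i & X j]} ->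
  bexp s (fun E => \prod_(j <- r) F j E) = \prod_(j <- r) bexp s (F j).
Proof.
elim: r => [|i r IHr] /=.
  move=> _ _ _; rewrite big_nil -[RHS](bexp_const s 1).
  by apply: eq_bexp => E; rewrite big_nil.
case/andP=> ir ur FX dX; rewrite big_cons -IHr //; first last.
- by move=> j k jr kr; apply: dX; rewrite inE ?jr ?kr orbT.
- by move=> j jr; apply: FX; rewrite inE jr orbT.
rewrite -(@bexp_indep s (X i) (\bigcup_(j <- r) X j)).
- by apply: eq_bexp => E; rewrite big_cons.
- by apply: FX; rewrite mem_head.
- move=> e E eX; apply: eq_big_seq => j jr; apply: FX; rewrite ?inE ?jr ?orbT //.
  apply: contra eX => eX; by rewrite in_bigcup_seq; apply/hasP; exists j.
rewrite disjoints_subset; apply/subsetP=> e eX; rewrite inE; apply/negP.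
rewrite in_bigcup_seq => /hasP[j jr eXj].
have /disjointFr : [disjoint X i & X j].
  by apply: dX; rewrite ?mem_head ?inE ?jr ?orbT //; apply: contraNneq ir => ->.
by move=> /(_ _ eX); rewrite eXj.
Qed.

Lemma bexp_mem0 s e : e \notin s -> bexp s (fun E => (e \in E)%:R) = 0.
Proof.
elim: s => [|x s IHs] /=; first by rewrite inE.
rewrite inE negb_or => /andP[ex es].
rewrite (eq_bexp s (g := fun E => (e \in E)%:R)) ?IHs ?mulr0 ?addr0 //.
by move=> E; rewrite !inE (negPf ex).
Qed.

Lemma bexp_mem s e : uniq s -> e \in s -> bexp s (fun E => (e \in E)%:R) = p.
Proof.
elim: s => [|x s IHs] //= /andP[xs us]; rewrite inE.
case: (eqVneq e x) => [->|ex] /=.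
  move=> _; rewrite bexp_mem0 // mulr0 addr0.
  by rewrite (eq_bexp s (g := fun=> 1)) ?bexp_const ?mulr1 // => E; rewrite setU11.
move=> es; rewrite (eq_bexp s (g := fun E => (e \in E)%:R)) ?IHs //; first by ring.
by move=> E; rewrite !inE (negPf ex).
Qed.

Lemma indep_off_mem e (h : bool -> R) :
  indep_off [set e] (fun E => h (e \in E)).
Proof. by move=> x E; rewrite !inE => xe; rewrite eq_sym (negPf xe). Qed.

Lemma bexp_subset s X : uniq s -> {subset X <= s} ->
  bexp s (fun E => (X \subset E)%:R) = p ^+ #|X|.
Proof.
move=> us Xs.
rewrite (eq_bexp s (g := fun E => \prod_(e <- enum X) (e \in E)%:R)); last first.
  move=> E; rewrite big_enum /=; case: (boolP (X \subset E)) => [/subsetP XE|].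
    by rewrite big1 // => e /XE ->.
  by case/subsetPn=> e eX eE; rewrite (bigD1 e) //= (negPf eE) mul0r.
rewrite (@bexp_prod _ _ _ (fun e => [set e])) ?enum_uniq //.
- rewrite big_enum /= (eq_bigr (fun=> p)) ?prodr_const // => e eX.
  by rewrite bexp_mem ?Xs.
- by move=> e _; apply: (indep_off_mem (fun b => b%:R)).
- by move=> e e' _ _ ee; rewrite disjoints1 inE.
Qed.

Definition meets X E := ~~ [disjoint X & E].

Lemma bexp_meets s X : uniq s -> {subset X <= s} ->
  bexp s (fun E => (meets X E)%:R) = 1 - (1 - p) ^+ #|X|.
Proof.
move=> us Xs.
rewrite (eq_bexp s (g := fun E => 1 - \prod_(e <- enum X) (1 - (e \in E)%:R)));
    last first.
  move=> E; rewrite big_enum /= /meets; case: (boolP [disjoint X & E]) => XE.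
    rewrite big1 ?subrr // => e eX.
    by rewrite (disjointFr XE eX) subr0.
  move: XE; rewrite disjoints_subset => /subsetPn[e eX].
  by rewrite inE negbK => eE; rewrite (bigD1 e) //= eE subrr mul0r subr0.
rewrite bexpB bexp_const (@bexp_prod _ _ _ (fun e => [set e])) ?enum_uniq //.
- rewrite big_enum /= (eq_bigr (fun=> 1 - p)) ?prodr_const // => e eX.
  by rewrite bexpB bexp_const bexp_mem ?Xs.
- by move=> e _; apply: (indep_off_mem (fun b => 1 - b%:R)).
- by move=> e e' _ _ ee; rewrite disjoints1 inE.
Qed.

Lemma indep_off_meets X (h : bool -> R) : indep_off X (fun E => h (meets X E)).
Proof.
move=> e E eX; congr (h (~~ _)).
rewrite !disjoints_subset; apply/subsetP/subsetP => sX x xX; have := sX x xX;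
  rewrite !inE ?negb_or; first by case/andP.
by move=> ->; rewrite andbT; apply: contraNneq eX => <-.
Qed.

Hypothesis p01 : 0 <= p <= 1.

Lemma ler_bexp s f g : (forall E, f E <= g E) -> bexp s f <= bexp s g.
Proof.
case/andP: p01 => p0 p1.
elim: s f g => //= e s IHs f g fg; apply: lerD; apply: ler_wpM2l;
  rewrite ?subr_ge0 //; exact: IHs.
Qed.

(* Union bound over the [m]-subsets of [X]. *)
Lemma bexp_card_ge s X m : uniq s -> {subset X <= s} ->
  bexp s (fun E => (m <= #|X :&: E|)%:R) <= 'C(#|X|, m)%:R * p ^+ m.
Proof.
move=> us Xs; set D := [set Y : {set I} | Y \subset X & #|Y| == m].
apply: (@le_trans _ _ (bexp s (fun E => \sum_(Y <- enum D) (Y \subset E)%:R))).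
  apply: ler_bexp => E; case: (leqP m #|X :&: E|) => [mX|_]; last first.
    by apply: sumr_ge0.
  have /card_geqP[r [ur sr /subsetP rXE]] := mX.
  have [rX rE] : [set x in r] \subset X /\ [set x in r] \subset E.
    by split; apply/subsetP=> x; rewrite inE => /(subsetP rXE); rewrite inE => /andP[].
  rewrite big_enum /= (bigD1 [set x in r]) /=; last first.
    by rewrite !inE rX cardsE -sr; apply/eqP/card_uniqP.
  by rewrite rE lerDl; apply: sumr_ge0.
rewrite bexp_sum big_enum /= -cards_draws -sum1_card natr_sum mulr_suml.
apply: ler_sum => Y; rewrite inE => /andP[/subsetP YX /eqP <-].
by rewrite mul1r bexp_subset // => e /YX /Xs.
Qed.

End BernoulliExpectation.

Section ErProb.
Local Open Scope ring_scope.

Lemma er_probE (R : realType) (T : finType) (p : R) (A : {set {set T}} -> Prop) :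
  er_prob p A = bexp p (enum (vpairs T)) (fun E => (`[< A E >])%:R).
Proof.
rewrite bexp_sumE ?enum_uniq // set_enum /er_prob [LHS]big_mkcondr /=.
apply: eq_bigr => E _; rewrite big_enum /=.
by case: ifP => _; rewrite ?mulr1 ?mulr0.
Qed.

End ErProb.

(** * Cluster dynamics *)

Section Dynamics.
Variables (T : finType) (puz ppl : rel T) (sigma tau : nat) (theta : option nat).
Implicit Types (P : {set {set T}}) (W A : {set T}).

Local Notation step := (jigsaw_step puz ppl sigma tau theta).
Local Notation mgraph := (merge_graph puz ppl sigma tau theta).

Lemma merge_graph_sym P : symmetric (mgraph P).
Proof.
move=> W1 W2; rewrite /merge_graph eq_sym orbC.
by case: (W1 \in P); case: (W2 \in P).
Qed.

Lemma connect_merge_sym P : connect_sym (mgraph P).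
Proof. exact/sym_connect_sym/merge_graph_sym. Qed.

Definition merged P W := cover [set W' in P | connect (mgraph P) W W'].

Lemma sub_merged P W W' :
  W' \in P -> connect (mgraph P) W W' -> W' \subset merged P W.
Proof. by move=> PW' cWW'; apply: bigcup_sup; rewrite inE PW'. Qed.

Lemma merged_in P W : W \in P -> merged P W \in step P.
Proof. by move=> PW; apply/imsetP; exists W. Qed.

Lemma merged_eq P W W' : connect (mgraph P) W W' -> merged P W = merged P W'.
Proof.
move=> cWW'; congr cover; apply/setP=> X; rewrite !inE.
by rewrite (same_connect (@connect_merge_sym P) cWW').
Qed.

Lemma singletons_partition : partition (singletons T) [set: T].
Proof.
apply/and3P; split.
- rewrite eqEsubset subsetT; apply/subsetP=> x _.
  by apply/bigcupP; exists [set x]; rewrite ?set11 //; apply: imset_f.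
- apply/trivIsetP=> _ _ /imsetP[x _ ->] /imsetP[y _ ->] xy.
  by rewrite disjoints1 inE; apply: contraNneq xy => ->.
- by apply/imsetP=> -[x _ /setP/(_ x)]; rewrite !inE eqxx.
Qed.

Lemma partition_jigsaw_step P :
  partition P [set: T] -> partition (step P) [set: T].
Proof.
move=> partP; case/and3P: (partP) => /eqP covP tiP P0.
apply/and3P; split.
- rewrite eqEsubset subsetT -covP; apply/subsetP=> x /bigcupP[W PW xW].
  apply/bigcupP; exists (merged P W); first exact: merged_in.
  by apply: subsetP xW; apply: sub_merged.
- apply/trivIsetP=> _ _ /imsetP[W1 PW1 ->] /imsetP[W2 PW2 ->].
  rewrite -/(merged P W1) -/(merged P W2); apply: contraR.
  rewrite disjoints_subset => /subsetPn[x /bigcupP[X1]].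
  rewrite inE => /andP[PX1 c1] xX1; rewrite inE negbK => /bigcupP[X2].
  rewrite inE => /andP[PX2 c2] xX2; apply/eqP.
  have eX : X1 = X2 by rewrite -(def_pblock tiP PX1 xX1) (def_pblock tiP PX2 xX2).
  by rewrite (merged_eq c1) (merged_eq c2) eX.
- apply/imsetP=> -[W PW E0].
  have : W \subset merged P W by apply: sub_merged.
  by rewrite /merged -E0 subset0 => /eqP W0; rewrite -W0 PW in P0.
Qed.

Lemma partition_iter t : partition (iter t step (singletons T)) [set: T].
Proof.
elim: t => [|t IHt]; first exact: singletons_partition.
exact: partition_jigsaw_step.
Qed.

Lemma jigsaw_step_merge P W1 W2 : W1 \in P -> W2 \in P ->
  jigsaw puz ppl sigma tau theta W1 W2 ->
  exists2 W, W \in step P & W1 :|: W2 \subset W.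
Proof.
move=> PW1 PW2 J; exists (merged P W1); first exact: merged_in.
rewrite subUset !sub_merged //; have [->//|n12] := eqVneq W1 W2.
by apply: connect1; rewrite /merge_graph PW1 PW2 n12 J.
Qed.

(** Asking for a block that contains [A], rather than equals it, makes the notion monotone. Growth
    can then be followed vertex by vertex although the parallel dynamics may merge much more. *)
Definition gathered A :=
  exists t W, W \in iter t step (singletons T) /\ A \subset W.

Lemma gatheredS A A' : A \subset A' -> gathered A' -> gathered A.
Proof.
by move=> sAA' [t [W [PW sW]]]; exists t, W; split; last exact: subset_trans sW.
Qed.

Lemma gathered1 x : gathered [set x].
Proof. by exists 0, [set x]; split=> //; apply: imset_f. Qed.

Lemma gathered_Solve : gathered [set: T] -> Solve puz ppl sigma tau theta.
Proof.
move=> [t [W [PW]]]; rewrite subTset => /eqP WT; exists t.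
case/and3P: (partition_iter t) => _ /trivIsetP tiP P0.
apply/setP=> B; rewrite inE; apply/idP/eqP => [PB|->]; last by rewrite -WT.
apply: contraNeq P0 => nB.
have := tiP B W PB PW; rewrite WT => /(_ nB).
by rewrite disjoints_subset setCT subset0 => /eqP <-.
Qed.

End Dynamics.

Section Growth.
Variables (T : finType) (puz ppl : rel T) (sigma : nat).
Implicit Types (A : {set T}).
Local Notation gathered := (gathered puz ppl sigma 1 None).

(** Take the block containing [A] and the block of [v] at the same time. If they differ, J1 or J3
    holds between them, since enlarging [A] to its block only adds neighbours; the next step merges
    them. *)
Lemma gathered_add A v u : gathered A -> u \in A -> puz v u ->
  ppl v u || (sigma <= #|[set w in A | ppl v w]|) ->
  gathered (v |: A).
Proof.
move=> [t [W [PW sAW]]] uA vu pv.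
case/and3P: (partition_iter puz ppl sigma 1 None t) => /eqP covP tiP P0.
have /bigcupP[X PX vX] : v \in cover (iter t (jigsaw_step puz ppl sigma 1 None) (singletons T)).
  by rewrite covP.
have uW := subsetP sAW u uA.
have [XW|nXW] := eqVneq X W.
  exists t, W; split=> //; rewrite subUset sub1set sAW -XW.
  by rewrite vX.
have vW : v \notin W.
  by apply: contraNN nXW => vW; rewrite -(def_pblock tiP PX vX) (def_pblock tiP PW vW).
have J : jigsaw puz ppl sigma 1 None X W.
  rewrite /jigsaw /=; case/orP: pv => pv; apply/orP; [left|right].
    by apply/existsP; exists v; rewrite vX; apply/existsP; exists u; rewrite uW pv.
  apply/existsP; exists v; rewrite vX /=; apply/andP; split.
    apply: (leq_trans pv); apply/subset_leq_card/subsetP=> w.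
    rewrite !inE => /andP[wA ->]; rewrite andbT (subsetP sAW w wA) andbT.
    by apply: contraNneq vW => <-; apply: (subsetP sAW).
  apply/card_gt0P; exists u; rewrite !inE uW vu !andbT.
  by apply: contraNneq vW => <-.
have [Y PY sY] := jigsaw_step_merge PX PW J.
exists t.+1, Y; split=> //; apply: subset_trans sY.
by apply: setUSS => //; rewrite sub1set.
Qed.

End Growth.

(** * Internally spanned sets *)

(** The last clause keeps the far endpoint in the component of [x], which the later growth and
    maximality arguments rely on. *)
Lemma connect_crossing (T : finType) (e : rel T) (A : {pred T}) x y :
  connect e x y -> x \in A -> y \notin A ->
  exists a b, [/\ a \in A, b \notin A, e a b & connect e x b].
Proof.
case/connectP=> p; elim/last_ind: p y => [|p z IHp] y /=.
  by move=> _ -> ->.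
rewrite rcons_path last_rcons => /andP[pp ez] -> xA zA.
case: (boolP (last x p \in A)) => lA; last exact: (IHp _ pp).
exists (last x p), z; split=> //; apply: connect_trans (connect1 ez).
by apply/connectP; exists p.
Qed.

Lemma card_disjointU (T : finType) (A B : {set T}) :
  [disjoint A & B] -> #|A :|: B| = #|A| + #|B|.
Proof. by rewrite -setI_eq0 cardsU => /eqP ->; rewrite cards0 subn0. Qed.

Section InnerPairs.
Variable T : finType.
Implicit Types (S C : {set T}) (Y : {set {set T}}).

(** The size condition selects genuine vertex pairs. Without it the empty set would lie inside every
    [S], and disjoint vertex sets would not give disjoint families. *)
Definition inner Y S := [set e in Y | (e \subset S) && (#|e| == 2)].

Lemma disjoint_inner Y1 Y2 S1 S2 :
  [disjoint S1 & S2] -> [disjoint inner Y1 S1 & inner Y2 S2].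
Proof.
move=> dS; rewrite -setI_eq0; apply/eqP/setP=> e; rewrite !inE; apply/negP.
case/andP=> /and3P[_ e1 ce] /and3P[_ e2 _].
have : e \subset S1 :&: S2 by rewrite subsetI e1.
move: dS; rewrite -setI_eq0 => /eqP ->; rewrite subset0 => /eqP e0.
by rewrite e0 cards0 in ce.
Qed.

Lemma set2_inj (v : T) : {in [pred w | w != v] &, injective (fun w => [set v; w])}.
Proof.
move=> w w' /= wv w'v /setP/(_ w); rewrite !inE eqxx orbT (negPf wv) /=.
by move=> /esym/eqP.
Qed.

(** Pairs inside [S1], pairs inside [S2] and pairs from [v] to [C] form three disjoint families.
    Hence edges consumed by a merge are never counted again. *)
Lemma card_inner_setU Y S1 S2 C v : [disjoint S1 & S2] -> v \in S1 ->
  C \subset S2 -> {in C, forall w, [set v; w] \in Y} ->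
  #|inner Y S1| + #|inner Y S2| + #|C| <= #|inner Y (S1 :|: S2)|.
Proof.
move=> dS vS1 /subsetP CS2 CY.
have vC w : w \in C -> w != v.
  by move=> /CS2 wS2; apply: contraTneq wS2 => ->; rewrite (disjointFr dS).
pose X := [set [set v; w] | w in C].
have cX : #|X| = #|C|.
  by apply: card_in_imset => w w' wC w'C; apply: set2_inj; apply: vC.
have d12 := disjoint_inner Y Y dS.
have d3 : [disjoint inner Y S1 :|: inner Y S2 & X].
  rewrite disjoint_sym disjoints_subset; apply/subsetP=> _ /imsetP[w wC ->].
  rewrite !inE !subUset !sub1set vS1 (disjointFl dS (CS2 _ wC)) (disjointFr dS vS1).
  by rewrite /= !andbF.
rewrite -cX -(card_disjointU d12) -(card_disjointU d3); apply/subset_leq_card.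
apply/subsetP=> e; rewrite !inE -orbA; case/or3P.
- by case/and3P=> -> eS ->; rewrite (subset_trans eS) ?subsetUl.
- by case/and3P=> -> eS ->; rewrite (subset_trans eS) ?subsetUr.
case/imsetP=> w wC ->; rewrite CY // subUset !sub1set !inE vS1 (CS2 _ wC) orbT.
by rewrite cards2 [v == w]eq_sym (vC _ wC).
Qed.

Lemma innerI Y E S : inner (Y :&: E) S = inner Y S :&: E.
Proof.
by apply/setP=> x; rewrite !inE; case: (x \in Y); case: (x \in E);
  rewrite ?andbF ?andbT.
Qed.

Lemma inner_vpairs Y S : {subset inner Y S <= enum (vpairs T)}.
Proof. by move=> x; rewrite mem_enum !inE => /and3P[]. Qed.

End InnerPairs.

(** * Closed walks covering a cluster *)

Section ClosedWalks.
Variables (T : finType) (e : rel T).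
Hypothesis e_sym : symmetric e.
Implicit Types (S : {set T}).

(* A depth-first traversal of a spanning tree of [S], started anywhere. *)
Definition traversable S := forall v, v \in S ->
  exists p, [/\ path e v p, last v p = v, S =i v :: p & size p = #|S|.-1.*2].

Lemma traversable1 x : traversable [set x].
Proof.
by move=> v /set1P ->; exists [::]; split=> //; rewrite ?cards1 // => y; rewrite !inE.
Qed.

(** Follow the walk of the first set until it reaches [a], cross to [b], run the closed walk of the
    second set, cross back and resume. The two crossings account for the increase from
    [2(|A|-1) + 2(|B|-1)] to [2(|A|+|B|-1)]. *)
Lemma traversableU S1 S2 u1 u2 : [disjoint S1 & S2] ->
  u1 \in S1 -> u2 \in S2 -> e u1 u2 ->
  traversable S1 -> traversable S2 -> traversable (S1 :|: S2).
Proof.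
suff half (A B : {set T}) a b v : [disjoint A & B] -> a \in A -> b \in B -> e a b ->
    traversable A -> traversable B -> v \in A ->
    exists p, [/\ path e v p, last v p = v, A :|: B =i v :: p &
                  size p = #|A :|: B|.-1.*2].
  move=> d12 u1S u2S e12 t1 t2 v /setUP[]; first exact: (half _ _ u1 u2).
  by rewrite setUC; apply: (half _ _ u2 u1); rewrite 1?disjoint_sym // e_sym.
move=> dAB aA bB eab tA tB vA.
have [p [pp lp Ap sp]] := tA v vA; have [q [pq lq Bq sq]] := tB b bB.
have : a \in v :: p by rewrite -Ap.
rewrite inE => /predU1P av.
have [p1 [p2 [def_p l1]]] : exists p1 p2, p = p1 ++ p2 /\ last v p1 = a.
  case: av => [->|/path.splitP[q1 q2]]; first by exists [::], p.
  by exists (rcons q1 a), q2; rewrite last_rcons.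
have A0 : 0 < #|A| by apply/card_gt0P; exists v.
have B0 : 0 < #|B| by apply/card_gt0P; exists b.
exists (p1 ++ (b :: q) ++ (a :: p2)); split.
- move: pp; rewrite def_p !cat_path /= l1 => /andP[-> ->].
  by rewrite eab pq lq e_sym eab.
- by rewrite !last_cat /= -[RHS]lp def_p last_cat l1.
- move=> x; rewrite in_setU Ap Bq def_p -!cat_cons !(mem_cat, inE).
  have : (x == a) ==> ((x == v) || (x \in p1)).
    apply/implyP=> /eqP ->; rewrite -l1; have := mem_last v p1.
    by rewrite inE.
  by case: (x == a); case: (x == v); case: (x \in p1); case: (x \in p2);
    case: (x == b); case: (x \in q).
rewrite card_disjointU //; move: sp; rewrite def_p !size_cat /= sq; lia.
Qed.

End ClosedWalks.

(** * Edge counts in clusters built by successive merges *)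

Section Seeds.
Variables (T : finType) (puz : rel T) (E : {set {set T}}) (sigma : nat).
Hypothesis puz_sym : symmetric puz.
Implicit Types (S : {set T}).

Definition puz_edges : {set {set T}} :=
  [set e : {set T} | [exists v, exists w, puz v w && (e == [set v; w])]].

Lemma puz_edge v w : puz v w -> [set v; w] \in puz_edges.
Proof.
by move=> vw; rewrite inE; apply/existsP; exists v; apply/existsP; exists w; rewrite vw eqxx.
Qed.

(* [a] and [b] count the merges that used a double edge, respectively
   [sigma] people edges. *)
Definition seeded S := S != set0 /\ traversable puz S /\
  exists a b, [/\ #|S| = (a + b).+1,
    a <= #|inner (puz_edges :&: E) S| & sigma * b <= #|inner E S|].

Lemma seeded1 x : seeded [set x].
Proof.
split; first by apply/set0Pn; exists x; rewrite set11.
split; first exact: traversable1.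
by exists 0, 0; rewrite cards1 muln0.
Qed.

(** A J1 merge supplies one new double edge and raises [a]; a J3 merge supplies [sigma] new people
    edges from one vertex and raises [b]. In both cases some puzzle edge joins the sets, so the
    traversals can be spliced. *)
Lemma seededU S1 S2 : [disjoint S1 & S2] ->
  jigsaw puz (edge_rel E) sigma 1 None S1 S2 ->
  seeded S1 -> seeded S2 -> seeded (S1 :|: S2).
Proof.
move=> dS J [S10 [t1 [a1 [b1 [c1 A1 B1]]]]] [S20 [t2 [a2 [b2 [c2 A2 B2]]]]].
split; first by rewrite setU_eq0 negb_and S10.
have [v vS1 Jv] : exists2 v, v \in S1 &
    (exists w, [/\ w \in S2, puz v w & edge_rel E v w]) \/
    (exists w, w \in S2 /\ puz v w) /\ sigma <= #|[set w in S2 | edge_rel E v w]|.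
  case/orP: J => /existsP[v /andP[vS1]].
    case/existsP=> w /andP[wS2 /andP[pw ew]]; exists v => //.
    by left; exists w.
  case/andP=> cv lv; exists v => //; right.
  have vS2 : S2 :\ v = S2 by apply/setP=> x; rewrite !inE; case: eqVneq => // ->;
      rewrite (disjointFr dS).
  rewrite /coll /link /nbr_count vS2 in cv lv; split=> //.
  by case/card_gt0P: lv => w; rewrite inE => /andP[]; exists w.
split.
  have [w [wS2 vw]] : exists w, w \in S2 /\ puz v w.
    by case: Jv => [[w []]|[]//]; exists w.
  exact: (traversableU puz_sym dS vS1 wS2 vw).
have eS w : w \in S2 -> [set w] \subset S2 by rewrite sub1set.
have n0 := card_inner_setU dS vS1 (sub0set S2).
case: Jv => [[w [wS2 vw ew]]|[_ cv]].
  exists (a1 + a2).+1, (b1 + b2); split.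
  - by rewrite card_disjointU // c1 c2; lia.
  - have := card_inner_setU (Y := puz_edges :&: E) dS vS1 (eS _ wS2).
    rewrite cards1 => H; apply: leq_trans (H _); first lia.
    by move=> x /set1P ->; rewrite inE puz_edge.
  - have := @n0 E; rewrite cards0 addn0 => H; apply: leq_trans (H _); first lia.
    by move=> x; rewrite inE.
exists (a1 + a2), (b1 + b2).+1; split.
- by rewrite card_disjointU // c1 c2; lia.
- have := @n0 (puz_edges :&: E); rewrite cards0 addn0 => H.
  by apply: leq_trans (H _); [lia|move=> x; rewrite inE].
have sC : [set w in S2 | edge_rel E v w] \subset S2.
  by apply/subsetP=> w; rewrite inE => /andP[].
have := card_inner_setU (Y := E) dS vS1 sC => H; apply: leq_trans (H _).
  by rewrite mulnS mulnDr; lia.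
by move=> w; rewrite inE => /andP[].
Qed.

Lemma jigsawS (ppl : rel T) W1 W2 S : jigsaw puz ppl sigma 1 None W1 W2 -> W1 \subset S ->
  jigsaw puz ppl sigma 1 None S W2.
Proof.
move=> J /subsetP sW; case/orP: J => /existsP[v /andP[vW Jv]]; apply/orP;
  [left|right]; by apply/existsP; exists v; rewrite sW.
Qed.

Lemma jigsawS_r (ppl : rel T) W1 W2 S : jigsaw puz ppl sigma 1 None W1 W2 -> W2 \subset S ->
  jigsaw puz ppl sigma 1 None W1 S.
Proof.
move=> J sW; case/orP: J => /existsP[v /andP[vW Jv]]; apply/orP; [left|right];
  apply/existsP; exists v; rewrite vW /=.
  by case/existsP: Jv => w /andP[/(subsetP sW) wS Jw]; apply/existsP; exists w; rewrite wS.
have mono (e : rel T) : nbr_count e v W2 <= nbr_count e v S.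
  apply/subset_leq_card/subsetP=> w; rewrite !inE.
  by case/andP=> /andP[-> /(subsetP sW) ->].
by case/andP: Jv => c l; rewrite (leq_trans c (mono _)) (leq_trans l (mono _)).
Qed.

(* Merging clusters two at a time at most doubles the size at each merge. *)
Lemma Solve_seeded k : 0 < k < #|T| ->
  Solve puz (edge_rel E) sigma 1 None ->
  exists S, seeded S /\ k < #|S| <= k.*2.
Proof.
case/andP=> k0 kT [t St]; apply: contrapT => noS.
(* A union of two small seeded sets has at most [2k] vertices. If it had more than [k], it would be
   the set whose existence [noS] denies. *)
have small S1 S2 : [disjoint S1 & S2] -> seeded S1 -> seeded S2 ->
    #|S1| <= k -> #|S2| <= k ->
    jigsaw puz (edge_rel E) sigma 1 None S1 S2 ||
      jigsaw puz (edge_rel E) sigma 1 None S2 S1 ->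
    seeded (S1 :|: S2) /\ #|S1 :|: S2| <= k.
  move=> dS sS1 sS2 l1 l2 J; have sS : seeded (S1 :|: S2).
    case/orP: J => J; first exact: seededU.
    by rewrite setUC; apply: seededU => //; rewrite disjoint_sym.
  split=> //; rewrite leqNgt; apply/negP=> kS; apply: noS.
  exists (S1 :|: S2); split=> //; rewrite kS card_disjointU //; lia.
suff inv : forall t W, W \in iter t (jigsaw_step puz (edge_rel E) sigma 1 None) (singletons T) ->
    seeded W /\ #|W| <= k.
  have := inv t [set: T]; rewrite St set11 => /(_ isT) [_].
  by rewrite cardsT leqNgt kT.
elim=> [|{St}t' IHt] W.
  by case/imsetP=> x _ ->; rewrite cards1; split=> //; exact: seeded1.
set P := iter t' _ _ in IHt *; rewrite [iter _ _ _]/=.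
have /and3P[_ /trivIsetP tiP _] : partition P [set: T] by apply: partition_iter.
rewrite -/P => /imsetP[W0 PW0 ->].
set mg := merge_graph _ _ _ _ _ _; set comp := [set W' in P | connect mg W0 W'].
(* One step may merge many blocks at once. They are adjoined one at a time, starting from [W0]: a
   maximal good subfamily of the component must be all of it, as any crossing edge of the merge
   graph would allow one more block. *)
pose good (C : {set {set T}}) :=
  [&& W0 \in C, C \subset comp & `[< seeded (cover C) /\ #|cover C| <= k >]].
have [|C /maxsetP[/and3P[C0 sC /asboolP[seC kC]] maxC]] := @ex_maxset _ good.
  exists [set W0]; rewrite /good set11 sub1set inE PW0 connect0 /=.
  by apply/asboolP; rewrite /cover big_set1; apply: IHt.
suff -> : comp = C by [].
apply/eqP; rewrite eqEsubset sC andbT; apply/subsetP=> B.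
rewrite inE => /andP[PB cB]; apply: contraT => nCB.
have [A1 [B1 [CA1 CB1 mg1 cB1]]] := connect_crossing cB C0 nCB.
case/and4P: mg1 => PA1 PB1 AB1 J.
have dB1 : [disjoint cover C & B1].
  rewrite disjoints_subset; apply/bigcupsP=> X CX; rewrite -disjoints_subset.
  apply: tiP => //; last by apply: contraNneq CB1 => <-.
  by move/subsetP: sC => /(_ X CX); rewrite inE => /andP[].
have sA1 : A1 \subset cover C by apply: bigcup_sup.
have [seB1 kB1] := IHt _ PB1.
have [] := small _ _ dB1 seC seB1 kC kB1.
  case/orP: J => J; first by rewrite (jigsawS J sA1).
  by rewrite (jigsawS_r J sA1) orbT.
move=> seU kU; have gU : good (B1 |: C).
  rewrite /good in_setU1 C0 orbT subUset sub1set inE PB1 cB1 sC /=.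
  by rewrite /cover bigcup_setU big_set1 setUC; apply/asboolP.
by rewrite -(maxC _ gU (subsetUr _ _)) setU11 in CB1.
Qed.

End Seeds.

(** * Few seeds below the threshold *)

Section Traces.
Variables (T : finType) (e : rel T).

(* The vertex sets of the walks of length at most [n] from [v]; walks are
   padded with idle steps to have length exactly [n]. *)
Fixpoint traces n v : seq {set T} :=
  if n is n'.+1 then
    [seq v |: A | w <- v :: enum [set w | e v w], A <- traces n' w]
  else [:: [set v]].

Lemma tracesS n v : traces n.+1 v =
  [seq v |: A | w <- v :: enum [set w | e v w], A <- traces n w].
Proof. by []. Qed.

Lemma traces_path n v p :
  path e v p -> size p <= n -> [set x in v :: p] \in traces n v.
Proof.
have s1 (x : T) : [set y in [:: x]] = [set x] by apply/setP=> y; rewrite !inE.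
elim: n v p => [|n IHn] v p; first by case: p => // _ _; rewrite s1 mem_head.
rewrite tracesS; case: p => [|w p].
  move=> _ _; apply/allpairsPdep; exists v, [set y in [:: v]].
  by rewrite mem_head IHn // s1 setUid.
move=> /andP[vw pp] sp; apply/allpairsPdep; exists w, [set y in w :: p].
rewrite IHn // inE mem_enum inE vw orbT; split=> //.
by apply/setP=> y; rewrite !inE.
Qed.

Lemma size_traces D n v : (forall u, #|[set w | e u w]| <= D) ->
  size (traces n v) <= D.+1 ^ n.
Proof.
move=> degD; elim: n v => [|n IHn] v //.
rewrite tracesS size_allpairs_dep expnS sumnE big_map.
apply: (@leq_trans (\sum_(w <- v :: enum [set w | e v w]) D.+1 ^ n)).
  by apply: leq_sum => w _.
rewrite big_const_seq count_predT iter_addn_0 /= -cardE mulnC leq_mul2r.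
by rewrite ltnS degD orbT.
Qed.

Lemma card_puz_edges D S : (forall u, #|[set w | e u w]| <= D) ->
  #|inner (puz_edges e) S| <= #|S| * D.
Proof.
move=> degD.
apply: (@leq_trans #|\bigcup_(v in S) [set [set v; w] | w in [set w | e v w]]|).
  apply/subset_leq_card/subsetP=> x; rewrite !inE => /andP[/existsP[v /existsP[w]]].
  case/andP=> vw /eqP -> /andP[]; rewrite subUset !sub1set => /andP[vS _] _.
  by apply/bigcupP; exists v => //; apply: imset_f; rewrite inE.
apply: leq_trans (_ : \sum_(v in S) D <= _); last by rewrite sum_nat_const.
elim/big_rec2: _ => [|v m X _ IH]; first by rewrite cards0.
rewrite (leq_trans (leq_card_setU _ _)) // leq_add //.
exact: leq_trans (leq_imset_card _ _) (degD v).
Qed.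

Lemma card_inner (Y : {set {set T}}) S : #|inner Y S| <= #|S| ^ 2.
Proof.
rewrite -mulnn -cardsX.
apply: leq_trans (leq_imset_card (fun vw : T * T => [set vw.1; vw.2]) _).
apply/subset_leq_card/subsetP=> x; rewrite inE => /and3P[_ xS /cards2P[v [w [_ ex]]]].
move: xS; rewrite ex subUset !sub1set => vwS.
by apply: (imset_f (fun vw : T * T => [set vw.1; vw.2]) (x := (v, w))); rewrite inE.
Qed.

End Traces.

Lemma bin_le_exp2 n m : 'C(n, m) <= 2 ^ n.
Proof.
elim: n m => [|n IHn] [|m]; rewrite ?bin0 ?expn_gt0 //.
by rewrite binS expnS mul2n -addnn leq_add.
Qed.

Section FewSeeds.
Local Open Scope ring_scope.
Variables (R : realType) (G : sgraph) (D sigma h : nat) (p : R).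
Hypotheses (degD : (max_degree G <= D)%N) (p01 : 0 <= p <= 1).

Let deg (u : G) : (#|[set w | adj u w]| <= D)%N.
Proof. by apply: leq_trans degD; apply: (leq_bigmax u). Qed.

(** Union bound over the possible traces of a seeded set with [2h < |S| <= 4h], whose traversal has
    length at most [8h]. Inside [S] there are at most [4hD] puzzle edges and at most [(4h)^2] pairs,
    which gives the two counting factors. *)
Lemma solve_prob_le : (0 < h)%N -> (h.*2 < #|{: G}|)%N ->
  solve_prob G sigma 1 None p <=
  (#|{: G}| * D.+1 ^ (8 * h))%:R *
    ((2 ^ (4 * h * D))%:R * p ^+ h + 'C((4 * h) ^ 2, sigma * h)%:R * p ^+ (sigma * h)).
Proof.
move=> h0 hN; case/andP: (p01) => p0 p1.
rewrite /solve_prob er_probE.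
pose L := [seq S : {set G} <- flatten [seq traces (@adj G) (8 * h) v | v <- enum G]
           | (#|S| <= 4 * h)%N].
have sL : (size L <= #|{: G}| * D.+1 ^ (8 * h))%N.
  rewrite size_filter (leq_trans (count_size _ _)) // size_flatten /shape -map_comp.
  rewrite sumnE big_map big_enum /= -sum_nat_const leq_sum // => v _.
  exact: size_traces.
pose ev1 (S : {set G}) (E : {set {set G}}) : R :=
  (h <= #|inner (puz_edges (@adj G)) S :&: E|)%:R.
pose ev2 (S : {set G}) (E : {set {set G}}) : R := (sigma * h <= #|inner setT S :&: E|)%:R.
apply: (@le_trans _ _ (bexp p (enum (vpairs G)) (fun E => \sum_(S <- L) (ev1 S E + ev2 S E)))).
  apply: ler_bexp => // E; case: asboolP => [sE|_]; last first.
    by apply: sumr_ge0 => S _; rewrite addr_ge0.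
  have [|S [[S0 [tS [a [b [cS aS bS]]]]] /andP[kS Sk]]] :=
    Solve_seeded (@adj_sym G) _ sE (k := h.*2).
    by rewrite double_gt0 h0.
  have SL : S \in L.
    rewrite mem_filter; apply/andP; split; first lia.
    have /set0Pn[v vS] := S0; apply/flattenP.
    exists (traces (@adj G) (8 * h) v); first by apply: map_f; rewrite mem_enum.
    have [q [pq _ Sq sq]] := tS v vS.
    have -> : S = [set x in v :: q] by apply/setP=> x; rewrite inE -Sq.
    by apply: traces_path => //; rewrite sq; lia.
  rewrite (big_rem S) //= -[leLHS]addr0 lerD //; last first.
    by apply: sumr_ge0 => S' _; rewrite addr_ge0.
  rewrite innerI // in aS; rewrite -[E]setTI innerI // in bS.
  (* Here [a + b = |S| - 1 >= 2h], so one of the two kinds of merge occurred at least [h] times. *)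
  have [ah|bh] : (h <= a \/ h <= b)%N by lia.
    by rewrite /ev1 (leq_trans ah aS) lerDl.
  by rewrite /ev2 (leq_trans _ bS) ?lerDr // leq_mul2l bh orbT.
rewrite bexp_sum; set c := (_ + _ : R).
apply: (@le_trans _ _ (\sum_(S <- L) c)).
  rewrite big_seq [leRHS]big_seq; apply: ler_sum => S.
  rewrite mem_filter => /andP[cS _]; rewrite bexpD; apply: lerD.
    apply: (le_trans (bexp_card_ge p01 _ (enum_uniq _) (@inner_vpairs _ _ _))).
    rewrite ler_wpM2r ?exprn_ge0 // ler_nat (leq_trans (bin_le_exp2 _ _)) //.
    rewrite leq_exp2l //; apply: leq_trans (card_puz_edges _ deg) _.
    by rewrite leq_mul2r cS orbT.
  apply: (le_trans (bexp_card_ge p01 _ (enum_uniq _) (@inner_vpairs _ _ _))).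
  rewrite ler_wpM2r ?exprn_ge0 // ler_nat leq_bin2l //.
  by rewrite (leq_trans (card_inner _ _)) // leq_exp2r.
rewrite big_const_seq count_predT iter_addr_0 -[leLHS]mulr_natl ler_wpM2r ?ler_nat //.
by rewrite addr_ge0 // mulr_ge0 ?exprn_ge0.
Qed.

End FewSeeds.

(** * Packing trees and growing from one of them *)

Section Packing.
Variables (T : finType) (e : rel T) (D L : nat).
Hypotheses (e_sym : symmetric e) (e_conn : forall v w, connect e v w).
Hypothesis degD : forall v, #|[set w | e v w]| <= D.
Hypotheses (L_gt0 : 0 < L) (L_le : L <= #|T|).
Implicit Types (s : seq T) (t : L.-tuple T).

Definition tree_ordered s :=
  forall x0 i, 0 < i < size s -> has (e (nth x0 s i)) (take i s).

Lemma tree_ordered_rcons s b : s != [::] -> tree_ordered s -> has (e b) s ->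
  tree_ordered (rcons s b).
Proof.
move=> s0 os eb x0 i; rewrite size_rcons => /andP[i0]; rewrite ltnS leq_eqVlt => /predU1P[->|lis].
  by rewrite nth_rcons ltnn eqxx -cats1 take_size_cat.
rewrite nth_rcons lis -cats1 takel_cat 1?ltnW //.
by apply: os; rewrite i0.
Qed.

Lemma exists_tree_ordered (r : rel T) x m : subrel r e ->
  0 < m <= #|[set y | connect r x y]| ->
  exists s, [/\ size s = m, uniq s, {in s, forall y, connect r x y} & tree_ordered s].
Proof.
move=> re /andP[m0 mC].
suff [s [sm us sC os _]] : exists s, [/\ size s = m, uniq s,
    {in s, forall y, connect r x y}, tree_ordered s & x \in s] by exists s.
elim: m m0 mC => // -[_ _ _|m IHm _ mC].
  exists [:: x]; split; rewrite ?mem_head //.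
    by move=> y; rewrite inE => /eqP ->.
  by move=> x0 [|i] /andP[].
have [s [sm us sC os xs]] := IHm isT (ltnW mC).
have [y yC ys] : exists2 y, connect r x y & y \notin s.
  have : ~~ ([set y | connect r x y] \subset s).
    apply/negP=> /subset_leq_card; rewrite (card_uniqP us) sm => /(leq_trans mC).
    by rewrite ltnn.
  by case/subsetPn=> y; rewrite inE; exists y.
have [a [b [as_ bs ab xb]]] := connect_crossing yC xs ys.
exists (rcons s b); split.
- by rewrite size_rcons sm.
- by rewrite rcons_uniq bs.
- by move=> z; rewrite mem_rcons inE => /predU1P[->|/sC].
- apply: tree_ordered_rcons => //; first by case: (s) xs.
  by apply/hasP; exists a => //; rewrite e_sym re.
- by rewrite mem_rcons inE xs orbT.
Qed.

(* In a maximal packing by [L]-vertex trees, every component of the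
   complement has fewer than [L] vertices and touches a packed vertex. *)
Lemma exists_packing : exists B : {set L.-tuple T},
  [/\ {in B, forall t, uniq t /\ tree_ordered t},
      {in B &, forall t t', t != t' -> [disjoint [set x in t] & [set x in t']]} &
      #|T| <= #|B| * (L + L * (D * L))].
Proof.
pose good (B : {set L.-tuple T}) := `[<
  {in B, forall t, uniq t /\ tree_ordered t} /\
  {in B &, forall t t', t != t' -> [disjoint [set x in t] & [set x in t']]} >].
have [|B /maxsetP[/asboolP[gB dB] maxB]] := @ex_maxset _ good.
  by exists set0; apply/asboolP; split=> [t|t t']; rewrite inE.
exists B; split=> //.
pose U := \bigcup_(t in B) [set x in t].
have cU : #|U| <= #|B| * L.
  rewrite -sum_nat_const /U; elim/big_rec2: _ => [|t m X _ IH]; first by rewrite cards0.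
  rewrite (leq_trans (leq_card_setU _ _)) // leq_add // cardsE.
  by rewrite (leq_trans (card_size _)) // size_tuple.
pose r := [rel v w | [&& e v w, v \notin U & w \notin U]].
have r_sym : connect_sym r.
  by apply: sym_connect_sym => v w /=; rewrite e_sym; case: (v \in U); case: (w \in U).
have compU v w : connect r v w -> v \notin U -> w \notin U.
  case/connectP=> p; elim: p v => [|z p IHp] v /=; first by move=> _ ->.
  by case/andP=> /and3P[_ _ zU] pp lw _; apply: IHp zU.
have compL v : v \notin U -> #|[set y | connect r v y]| < L.
  move=> vU; rewrite ltnNge; apply/negP=> Lc.
  have re : subrel r e by move=> a b /and3P[].
  have [|s [sL us sC os]] := @exists_tree_ordered r v L re; first by rewrite L_gt0.
  pose t := tcast sL (in_tuple s).
  have ts : t = s :> seq T by rewrite val_tcast.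
  have mt : t =i s by move=> x; rewrite -ts.
  have sU x : x \in s -> x \notin U by move=> /sC /compU; apply.
  have tB t' : t' \in B -> [disjoint [set x in t] & [set x in t']].
    move=> Bt'; rewrite disjoints_subset; apply/subsetP=> x.
    rewrite in_set mt in_setC in_set => /sU; apply: contra => xt'.
    by apply/bigcupP; exists t'; rewrite ?inE.
  have : good (t |: B).
    apply/asboolP; split=> [t1|t1 t2].
      by case/setU1P=> [->|/gB]; first rewrite ts.
    case/setU1P=> [->|B1] /setU1P[->|B2]; rewrite ?eqxx // => n12.
    - exact: tB.
    - by rewrite disjoint_sym tB.
    - exact: dB.
  move/maxB/(_ (subsetUr _ _))=> EB.
  (* By maximality the new tree already belongs to the packing, yet its vertices avoid [U]. *)
  have Bt : t \in B by rewrite -EB setU11.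
  have : 0 < size s by rewrite sL.
  case: (s) sU mt => [//|z s'] sU mt _.
  have /negP[] : z \notin U by apply: sU; rewrite mem_head.
  by apply/bigcupP; exists t; rewrite ?in_set ?mt ?mem_head.
have T_gt0 : 0 < #|T| := leq_trans L_gt0 L_le.
have [x0 _] : exists x0, x0 \in T by apply/card_gt0P.
(* If [U] were empty, the whole connected graph would be a single component with at least [L]
   vertices. *)
have [u0 Uu0] : exists u0, u0 \in U.
  apply/set0Pn; apply/negP=> /eqP U0.
  have := compL x0; rewrite U0 inE => /(_ isT); rewrite ltnNge => /negP[].
  apply: (leq_trans L_le); rewrite -cardsT; apply/subset_leq_card/subsetP=> y _.
  rewrite inE; apply: connect_sub (e_conn x0 y) => a b ab.
  by apply: connect1; rewrite /= ab U0 !inE.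
(* Every component of the complement contains a neighbour of [U]. Each of the [|U|] vertices reaches
   at most [D] components, each with fewer than [L] vertices, so [|C| <= |U| D L]. *)
pose C := \bigcup_(u in U) \bigcup_(w in [set w | e u w && (w \notin U)]) [set y | connect r w y].
have TUC : [set: T] \subset U :|: C.
  apply/subsetP=> y _; rewrite inE; apply/orP.
  have [|yU] := boolP (y \in U); [by left|right].
  pose A := [pred z | connect r y z].
  have [||a [b [Aa Ab ab _]]] := @connect_crossing _ e A y u0 (e_conn y u0).
    by rewrite inE connect0.
    by rewrite inE; apply: contraTN Uu0 => /compU; apply.
  rewrite !inE in Aa Ab.
  have aU := compU _ _ Aa yU.
  have bU : b \in U.
    by apply: contraNT Ab => bU; apply: connect_trans Aa (connect1 _); rewrite /= ab aU.
  apply/bigcupP; exists b => //; apply/bigcupP; exists a; rewrite inE.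
    by rewrite e_sym ab.
  by rewrite r_sym.
have cC : #|C| <= #|U| * (D * L).
  rewrite -sum_nat_const /C; elim/big_rec2: _ => [|u m X Uu IH]; first by rewrite cards0.
  rewrite (leq_trans (leq_card_setU _ _)) // leq_add //.
  apply: (@leq_trans (\sum_(w in [set w | e u w && (w \notin U)]) L)).
    elim/big_rec2: _ => [|w n Y]; first by rewrite cards0.
    rewrite inE => /andP[_ wU] IH'.
    by rewrite (leq_trans (leq_card_setU _ _)) // leq_add // ltnW // compL.
  rewrite sum_nat_const leq_mul2r (leq_trans _ (degD u)) ?orbT //.
  by apply/subset_leq_card/subsetP=> w; rewrite !inE => /andP[].
rewrite -cardsT (leq_trans (subset_leq_card TUC)) // (leq_trans (leq_card_setU _ _)) //.
apply: (leq_trans (leq_add (leqnn _) cC)).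
by rewrite mulnDr [#|B| * (L * _)]mulnA leq_add // leq_mul2r cU orbT.
Qed.

End Packing.

(** * Solving the puzzle from one well-connected tree *)

Section Blocks.
Variables (T : finType) (sigma L : nat).
Hypothesis sigma_gt0 : 0 < sigma.
Implicit Types (E : {set {set T}}) (t : L.-tuple T) (K : pred 'I_L).

Definition spokes t v K : {set {set T}} := [set [set v; tnth t k] | k : 'I_L & K k].

(** Splitting earlier indices by residue modulo [sigma] replaces the event of having [sigma]
    collaborators by the stronger event that every class is hit. The latter is an intersection of
    independent events. *)
Definition inner_group t (i : 'I_L) (j : 'I_sigma) :=
  spokes t (tnth t i) [pred k : 'I_L | (k < i) && (k %% sigma == j)].

Definition outer_group t v (j : 'I_sigma) :=
  spokes t v [pred k : 'I_L | k %% sigma == j].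

Lemma meets_spokes t v K E : meets (spokes t v K) E ->
  exists2 k, K k & [set v; tnth t k] \in E.
Proof.
rewrite /meets disjoints_subset => /subsetPn[_ /imsetP[k Kk ->]].
by rewrite inE negbK; exists k => //; rewrite inE in Kk.
Qed.

Lemma card_spokes t v K : uniq t -> (forall k, K k -> tnth t k != v) ->
  #|spokes t v K| = #|K|.
Proof.
move=> /tuple_uniqP t_inj Kv; rewrite /spokes card_in_imset ?cardsE //.
move=> k k'; rewrite !inE => Kk Kk' /(@set2_inj T v) tt.
by apply: t_inj; apply: tt; rewrite inE Kv.
Qed.

(** Reduction modulo [sigma] maps the indices joined to [v] onto all [sigma] residues, so there are
    at least [sigma] of them. *)
Lemma collaborators t v K E : uniq t ->
  (forall j : 'I_sigma, meets (spokes t v [pred k : 'I_L | K k && (k %% sigma == j)]) E) ->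
  sigma <= #|[set w in [set tnth t k | k : 'I_L & K k] | edge_rel E v w]|.
Proof.
move=> /tuple_uniqP t_inj mE.
pose K' := [set k : 'I_L | K k && ([set v; tnth t k] \in E)].
pose res (k : 'I_L) : 'I_sigma := Ordinal (ltn_pmod k sigma_gt0).
apply: (@leq_trans #|[set tnth t k | k in K']|); last first.
  apply/subset_leq_card/subsetP=> x /imsetP[k kK' ->].
  move: kK'; rewrite [k \in _]inE => /andP[Kk kE].
  by rewrite in_set /edge_rel kE andbT; apply: imset_f; rewrite inE.
rewrite card_imset // -[leqLHS]card_ord -cardsT.
apply: leq_trans (leq_imset_card res _); apply/subset_leq_card/subsetP=> j _.
have [k /= /andP[Kk /eqP kj] kE] := meets_spokes (mE j).
by apply/imsetP; exists k; rewrite ?inE ?Kk //; apply: val_inj.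
Qed.

Variable puz : rel T.

(** Induction on prefixes. From index [sigma] on, all residue classes are required and J3 applies;
    before that, J1 applies through the earlier puzzle neighbour. *)
Lemma gathered_block t E : uniq t -> tree_ordered puz t ->
  (forall (i : 'I_L) (j : 'I_sigma), j < i -> meets (inner_group t i j) E) ->
  0 < L ->
  gathered puz (edge_rel E) sigma 1 None [set x in t].
Proof.
move=> ut ot mE L0.
suff take_gathered n : 0 < n <= L ->
    gathered puz (edge_rel E) sigma 1 None [set x in take n t].
  by have := take_gathered L; rewrite L0 leqnn take_oversize ?size_tuple //; apply.
case/andP; elim: n => [//|n IHn] _ nL.
pose i := Ordinal nL; have x0 := tnth t i.
rewrite (take_nth x0) ?size_tuple //.
have -> : nth x0 t n = tnth t i by rewrite (tnth_nth x0).
have takeE : [set x in take n t] = [set tnth t k | k : 'I_L & k < i].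
  apply/setP=> x; rewrite inE; apply/idP/imsetP=> [/(nthP x0)[k]|[k]].
    rewrite size_takel ?size_tuple ?(ltnW nL) // => kn <-.
    exists (Ordinal (ltn_trans kn nL)); rewrite ?inE //.
    by rewrite nth_take // (tnth_nth x0).
  rewrite inE => kn ->; rewrite (tnth_nth x0) -(nth_take x0 (n0 := n)) //.
  by apply: mem_nth; rewrite size_takel ?size_tuple ?(ltnW nL).
have -> : [set x in rcons (take n t) (tnth t i)] = tnth t i |: [set x in take n t].
  by apply/setP=> x; rewrite !inE mem_rcons inE.
have [n0|n0] := posnP n.
  rewrite n0 take0; apply: gatheredS (gathered1 _ _ _ _ _ (tnth t i)).
  by apply/subsetP=> x; rewrite !inE orbF.
have nt : 0 < n < size t by rewrite n0 size_tuple.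
have /hasP[u ut' pu] := ot x0 n nt.
rewrite (_ : nth x0 t n = tnth t i) in pu; last by rewrite (tnth_nth x0).
apply: (gathered_add (u := u)) => //; [exact: IHn n0 (ltnW nL)|by rewrite inE|].
apply/orP; have [sn|ns] := leqP sigma n.
  right; rewrite takeE; apply: collaborators => // j; apply: mE.
  exact: leq_trans (ltn_ord j) sn.
(* When [n < sigma], each residue class among the earlier indices is a single index. The group at
   the index of [u] is therefore the one pair joining the new vertex to its puzzle neighbour, and
   hitting it gives a double edge. *)
left; have : u \in [set tnth t k | k : 'I_L & k < i] by rewrite -takeE inE.
case/imsetP=> k; rewrite inE => ki uk.
have ks : k < sigma := ltn_trans ki ns.
have [k' /= /andP[k'i /eqP]] := meets_spokes (mE i (Ordinal ks) ki).
rewrite modn_small /= ?(ltn_trans k'i ns) // => kk'.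
by rewrite /edge_rel uk (_ : k' = k) //; apply: val_inj.
Qed.

Lemma Solve_block t E : (forall v w, connect puz v w) -> symmetric puz ->
  uniq t -> tree_ordered puz t -> 0 < L ->
  (forall (i : 'I_L) (j : 'I_sigma), j < i -> meets (inner_group t i j) E) ->
  (forall v (j : 'I_sigma), v \notin t -> meets (outer_group t v j) E) ->
  Solve puz (edge_rel E) sigma 1 None.
Proof.
move=> conn psym ut ot L0 inE' outE; apply: gathered_Solve.
suff grow n : n <= #|~: [set x in t]| -> exists A : {set T},
    [/\ [set x in t] \subset A, #|[set x in t]| + n <= #|A| &
        gathered puz (edge_rel E) sigma 1 None A].
  have [A [_ cA gA]] := grow _ (leqnn _).
  rewrite (_ : [set: T] = A) //; apply/esym/eqP; rewrite eqEcard subsetT cardsT.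
  by rewrite -(cardsC [set x in t]).
elim: n => [_|n IHn nC].
  by exists [set x in t]; rewrite subxx addn0 leqnn; split=> //; apply: gathered_block.
have [A [tA cA gA]] := IHn (ltnW nC).
have [AT|] := boolP ([set: T] \subset A).
  exists A; split=> //; move: AT; rewrite subTset => /eqP ->.
  by rewrite cardsT -(cardsC [set x in t]) leq_add2l.
case/subsetPn=> y _ yA.
have x0t : tnth t (Ordinal L0) \in A by apply: (subsetP tA); rewrite inE mem_tnth.
have [u [v [uA vA uv _]]] := connect_crossing (conn _ y) x0t yA.
have vt : v \notin t by apply: contra vA => vt; apply: (subsetP tA); rewrite inE.
exists (v |: A); split.
- exact: subset_trans tA (subsetUr _ _).
- by rewrite cardsU1 vA addnS add1n ltnS.
apply: (gathered_add (u := u)) => //; first by rewrite psym.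
apply/orP; right.
apply: leq_trans (@collaborators t v predT E ut _) _.
  by move=> j; apply: outE.
apply/subset_leq_card/subsetP=> w; rewrite !inE => /andP[/imsetP[k _ ->] ->].
by rewrite andbT; apply: (subsetP tA); rewrite inE mem_tnth.
Qed.

End Blocks.

Section GroupCards.
Variables (T : finType) (sigma L : nat) (t : L.-tuple T).
Hypotheses (sigma_gt0 : 0 < sigma) (t_uniq : uniq t).

Lemma card_residue_class (j : 'I_sigma) n c : n <= L ->
  (forall a, a < c -> a * sigma + j < n) ->
  c <= #|[pred k : 'I_L | (k < n) && (k %% sigma == j)]|.
Proof.
move=> nL cn; rewrite -[c]card_ord.
have lt (a : 'I_c) : a * sigma + j < L by apply: leq_trans (cn a (ltn_ord a)) nL.
pose f (a : 'I_c) := Ordinal (lt a).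
rewrite -(card_imset (f := f) 'I_c); last first.
  move=> a b [] /eqP; rewrite eqn_add2r eqn_mul2r eqn0Ngt sigma_gt0 => /eqP ab.
  exact: val_inj.
apply/subset_leq_card/subsetP=> _ /imsetP[a _ ->].
by rewrite inE /= cn ?ltn_ord // modnMDl modn_small /=.
Qed.

Lemma card_inner_group (i : 'I_L) (j : 'I_sigma) : j < i ->
  maxn 1 (i %/ sigma) <= #|inner_group t i j|.
Proof.
move=> ji; rewrite card_spokes //; last first.
  have t_inj : injective (tnth t) by exact/tuple_uniqP.
  move=> k /= /andP[ki _]; apply: contraTneq ki => /t_inj ->.
  by rewrite ltnn.
apply: card_residue_class => [|a]; first exact: ltnW.
rewrite leq_max => /orP[|ai]; first by rewrite ltnS leqn0 => /eqP ->.
apply: leq_trans (leq_trunc_div i sigma).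
by apply: leq_trans (_ : a.+1 * sigma <= _); rewrite ?leq_mul2r ?ai ?orbT //
   mulSn addnC ltn_add2r.
Qed.

Lemma card_outer_group m v (j : 'I_sigma) : v \notin t -> L = m * sigma ->
  m <= #|outer_group t v j|.
Proof.
move=> vt Lm; rewrite card_spokes //; last first.
  by move=> k _; apply: contraNneq vt => <-; rewrite mem_tnth.
apply: (@leq_trans #|[pred k : 'I_L | (k < L) && (k %% sigma == j)]|).
  apply: card_residue_class => // a am; rewrite Lm.
  by apply: leq_trans (_ : a.+1 * sigma <= _); rewrite ?leq_mul2r ?am ?orbT //
     mulSn addnC ltn_add2r.
by apply/subset_leq_card/subsetP=> k; rewrite !inE => /andP[].
Qed.

(** The larger index of a pair recovers [i], and the residue of the smaller one recovers [j]. *)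
Lemma disjoint_inner_groups (i i' : 'I_L) (j j' : 'I_sigma) :
  (i, j) != (i', j') -> [disjoint inner_group t i j & inner_group t i' j'].
Proof.
have t_inj : injective (tnth t) by exact/tuple_uniqP.
apply: contraR; rewrite disjoints_subset => /subsetPn[_ /imsetP[k + ->]].
rewrite inE => /andP[ki /eqP kj]; rewrite inE negbK => /imsetP[k' + /setP tt].
rewrite inE => /andP[k'i' /eqP k'j'].
have in2 (a b c d : 'I_L) : [set tnth t a; tnth t b] =i [set tnth t c; tnth t d] ->
    (a = c \/ a = d) /\ (b = c \/ b = d).
  move=> H; split.
    have := H (tnth t a); rewrite !inE eqxx /= => /esym/orP[] /eqP /t_inj; by [left|right].
  by have := H (tnth t b); rewrite !inE eqxx orbT => /esym/orP[] /eqP /t_inj; [left|right].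
have [H1 H2] := in2 _ _ _ _ tt.
have ii : i = i'.
  case: H1 => // ik'; case: H2 => ki'; last by move: ki; rewrite ki' ik' ltnn.
  by move: ki k'i'; rewrite ki' ik' => /ltn_trans /[apply]; rewrite ltnn.
have kk : k = k' by case: H2 => // ki'; move: ki; rewrite ki' ii ltnn.
by apply/eqP; congr (_, _) => //; apply: ord_inj; rewrite -kj -k'j' kk.
Qed.

End GroupCards.

Local Open Scope ring_scope.

(* With [s_n = sqrt (1 - x^n)] one has
   [- ln (1 - x^n) <= 2 x^n / s_n <= 4 (s_n - s_(n-1)) / (1 - x)], a telescoping bound. *)
Lemma prod_1subX_ge (R : realType) (x : R) n : 0 <= x < 1 ->
  expR (- (4 / (1 - x) * Num.sqrt (1 - x ^+ n))) <= \prod_(1 <= g < n.+1) (1 - x ^+ g).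
Proof.
case/andP=> x0 x1; elim: n => [|n IHn].
  by rewrite big_geq // expr0 subrr sqrtr0 mulr0 oppr0 expR0.
rewrite big_nat_recr //=.
set s := Num.sqrt _ in IHn; set s' := Num.sqrt (1 - x ^+ n.+1).
have x1' : 0 < 1 - x by rewrite subr_gt0.
have xn1 : x ^+ n <= 1 by rewrite exprn_ile1 // ltW.
have xn0 : 0 <= x ^+ n by rewrite exprn_ge0.
have xS1 : x ^+ n.+1 < 1 by rewrite exprn_ilt1.
have ss : s ^+ 2 = 1 - x ^+ n by rewrite sqr_sqrtr // subr_ge0.
have ss' : s' ^+ 2 = 1 - x ^+ n.+1 by rewrite sqr_sqrtr // subr_ge0 ltW.
have s0 : 0 <= s by apply: sqrtr_ge0.
have s'0 : 0 < s' by rewrite sqrtr_gt0 subr_gt0.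
have s'1 : s' <= 1 by rewrite -sqrtr1 ler_wsqrtr // gerBl exprn_ge0.
have ss'le : s <= s'.
  by apply: ler_wsqrtr; rewrite lerB // exprS ler_piMl // ltW.
apply: (@le_trans _ _ (expR (- (4 / (1 - x) * s)) * s' ^+ 2)); last first.
  by rewrite ss' ler_wpM2r // subr_ge0 ltW.
have -> : - (4 / (1 - x) * s') = - (4 / (1 - x) * s) + - (4 / (1 - x) * (s' - s)) by ring.
rewrite expRD ler_wpM2l ?expR_ge0 //.
(* Clearing denominators: [(1 - s')(1 - x) <= (1 - s'^2)(1 - x) <= x^n (1 - x) = (s' + s)(s' - s) <=
   2 s' (s' - s)]. It is then combined with [1/s' <= expR (1/s' - 1)], squared. *)
have key : s'^-1 - 1 <= 2 / (1 - x) * (s' - s).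
  have -> : s'^-1 - 1 = (1 - s') / s' by field; rewrite gt_eqF.
  rewrite ler_pdivrMr // [leRHS](_ : _ = (2 * (s' - s) * s') / (1 - x)); last by ring.
  rewrite ler_pdivlMr //; set y := x ^+ n in xn1 xn0 ss.
  have dss : (s' + s) * (s' - s) = y * (1 - x).
    have -> : (s' + s) * (s' - s) = s' ^+ 2 - s ^+ 2 by ring.
    by rewrite ss ss' exprS -/y; ring.
  apply: (@le_trans _ _ (y * (1 - x))).
    rewrite ler_wpM2r ?(ltW x1') //; apply: (@le_trans _ _ (1 - s' ^+ 2)).
      by rewrite lerB // expr2 ler_piMl // ltW.
    by rewrite ss' opprB addrC subrK exprS ler_piMl // ltW.
  rewrite -dss -mulrA [leRHS](_ : _ = (s' + s') * (s' - s)); last by ring.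
  by rewrite ler_wpM2r ?subr_ge0 // lerD2l.
apply: (@le_trans _ _ (expR (- (s'^-1 - 1)) ^+ 2)).
  rewrite -expRM_natl ler_expR mulrN lerN2.
  have -> : 4 / (1 - x) * (s' - s) = 2 * (2 / (1 - x) * (s' - s)) by ring.
  by rewrite ler_pM2l.
rewrite ler_pXn2r ?nnegrE ?expR_ge0 ?(ltW s'0) //.
rewrite expRN -[leRHS]invrK lef_pV2 ?posrE ?expR_gt0 ?invr_gt0 //.
by have := expR_ge1Dx (s'^-1 - 1); rewrite addrC subrK.
Qed.

(** * Probability that one of many disjoint trees solves the puzzle *)

Section ManyBlocks.
Variables (R : realType) (G : sgraph) (D sigma m : nat) (p : R).
Hypotheses (G_conn : connected_graph G) (degD : (max_degree G <= D)%N).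
Hypotheses (p_gt0 : 0 < p) (p_le1 : p <= 1).
Hypotheses (sigma_gt0 : (0 < sigma)%N) (m_gt0 : (0 < m)%N).
Local Notation L := (m * sigma)%N.
Local Notation T := (vertex G).
Implicit Types (t : L.-tuple T) (E : {set {set T}}).

Let p01 : 0 <= p <= 1. Proof. by rewrite ltW. Qed.
Let q01 : 0 <= 1 - p < 1. Proof. by rewrite subr_ge0 p_le1 gtrBl. Qed.

Lemma indep_off_spokes t v (K : pred 'I_L) (A : {set T}) (h : bool -> R) :
  v \in A -> [set x in t] \subset A -> v \notin [set tnth t k | k in K] ->
  indep_off (inner setT A) (fun E => h (meets (spokes t v K) E)).
Proof.
move=> vA /subsetP tA vK; apply: indep_offS (@indep_off_meets _ _ _ h).
apply/subsetP=> _ /imsetP[k Kk ->]; rewrite inE in_setT subUset !sub1set vA /=.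
rewrite tA ?inE ?mem_tnth //= cards2.
suff -> : v != tnth t k by [].
by apply: contraNneq vK => ->; apply: imset_f; rewrite inE in Kk.
Qed.

Lemma spokes_vpairs t v (K : pred 'I_L) : v \notin [set tnth t k | k in K] ->
  {subset spokes t v K <= enum (vpairs T)}.
Proof.
move=> vK _ /imsetP[k Kk ->]; rewrite mem_enum inE cards2.
suff -> : v != tnth t k by [].
by apply: contraNneq vK => ->; apply: imset_f; rewrite inE in Kk.
Qed.

(** The indicator of the event required by [gathered_block], written as a product so that
    independence factorises its expectation. *)
Definition block_event t E : R :=
  \prod_(ij <- enum [pred ij : 'I_L * 'I_sigma | (ij.2 < ij.1)%N])
     (meets (inner_group t ij.1 ij.2) E)%:R.

Lemma tnth_notin_earlier t (i : 'I_L) (j : 'I_sigma) : uniq t ->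
  tnth t i \notin [set tnth t k | k in [pred k : 'I_L | (k < i)%N && (k %% sigma == j)%N]].
Proof.
move=> /tuple_uniqP t_inj; apply/imsetP=> -[k]; rewrite inE => /andP[ki _] /t_inj ik.
by rewrite ik ltnn in ki.
Qed.

(** The group of [(i, j)] has at least [max(1, i / sigma)] pairs, with the quotient rounded down.
    Each quotient [g < m] comes from [sigma] indices [i] and [sigma] residues [j], whence the
    exponent [sigma ^ 2]. *)
Lemma bexp_block_event t : uniq t ->
  (p * expR (- (4 / p))) ^+ (sigma ^ 2) <= bexp p (enum (vpairs T)) (block_event t).
Proof.
move=> ut; case/andP: q01 => q0 q1.
rewrite /block_event (@bexp_prod _ _ _ _ _ _ (fun ij => inner_group t ij.1 ij.2)).
- rewrite big_enum /=.
  pose F g : R := 1 - (1 - p) ^+ maxn 1 g.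
  have F01 g : 0 <= F g <= 1.
    by rewrite subr_ge0 gerBl exprn_ge0 // exprn_ile1 // ltW.
  apply: (@le_trans _ _ (\prod_(ij : 'I_L * 'I_sigma | (ij.2 < ij.1)%N) F (ij.1 %/ sigma)%N)).
    (* Factors with [j >= i] may be inserted, as all factors are at most 1. *)
    apply: (@le_trans _ _ (\prod_(ij : 'I_L * 'I_sigma) F (ij.1 %/ sigma)%N)); last first.
      rewrite [leRHS]big_mkcond /=; apply: ler_prod => ij _.
      have /andP[F0 F1] := F01 (ij.1 %/ sigma)%N.
      by case: ifP => _; rewrite F0 ?lexx.
    rewrite -(pair_bigA _ (fun (i : 'I_L) (j : 'I_sigma) => F (i %/ sigma)%N)) /=.
    under eq_bigr do rewrite prodr_const card_ord.
    rewrite -(big_mkord xpredT (fun i => F (i %/ sigma)%N ^+ sigma)) big_nat_mul.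
    have Fg g : \prod_(g * sigma <= i < g.+1 * sigma) F (i %/ sigma)%N ^+ sigma =
                F g ^+ (sigma ^ 2).
      rewrite (eq_big_nat _ _ (F2 := fun=> F g ^+ sigma)) => [|i /andP[gi ig]].
        by rewrite prodr_const_nat mulSn addnK -exprM mulnn.
      rewrite -(subnKC gi) divnMDl // divn_small ?addn0 //.
      by rewrite ltn_subLR // addnC -mulSn.
    rewrite (eq_bigr _ (fun g _ => Fg g)) prodrXl.
    rewrite lerXn2r ?nnegrE ?mulr_ge0 ?expR_ge0 ?(ltW p_gt0) //.
      by apply: prodr_ge0 => g _; case/andP: (F01 g).
    (* The quotient [0] contributes exactly [p]; the other quotients are bounded by [prod_1subX_ge]
       with [x = 1 - p]. *)
    rewrite -(prednK m_gt0) big_nat_recl // [X in _ <= X * _]/F /= expr1 subKr.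
    rewrite ler_pM2l //; apply: le_trans (_ : \prod_(1 <= g < m.-1.+1) (1 - (1 - p) ^+ g) <= _).
      apply: le_trans (prod_1subX_ge _ q01); rewrite ler_expR lerN2 subKr.
      by rewrite ler_piMr ?divr_ge0 ?(ltW p_gt0) // -[leRHS]sqrtr1 ler_wsqrtr // gerBl exprn_ge0.
    rewrite big_add1 /= (eq_bigr (fun g => F g.+1)) // => g _.
    by rewrite /F (maxn_idPr _).
  apply: ler_prod => -[i j] /= ji; have /andP[-> _] := F01 (i %/ sigma)%N.
  rewrite bexp_meets ?enum_uniq //; last exact/spokes_vpairs/tnth_notin_earlier.
  by rewrite lerB // ler_wiXn2l ?card_inner_group // ltW.
- exact: enum_uniq.
- by move=> ij _; exact: (@indep_off_meets _ _ _ (fun b : bool => b%:R)).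
- by move=> [i j] [i' j'] _ _; apply: disjoint_inner_groups.
Qed.

Lemma block_eventE t E : block_event t E =
  [forall i : 'I_L, forall j : 'I_sigma, (j < i)%N ==> meets (inner_group t i j) E]%:R.
Proof.
rewrite /block_event big_enum /=; case: forallP => [mE|nE].
  by rewrite big1 // => -[i j] /= ji; have /forallP/(_ j)/implyP-> := mE i.
case: (pickP [pred ij : 'I_L * 'I_sigma |
    (ij.2 < ij.1)%N && ~~ meets (inner_group t ij.1 ij.2) E]) => [ij /andP[ji nm]|all_m].
  by rewrite (bigD1 ij) //= (negPf nm) mul0r.
case: nE => i; apply/forallP=> j; apply/implyP=> ji.
by have := all_m (i, j); rewrite /= ji /= => /negbFE.
Qed.

Lemma indep_off_block_event t : uniq t ->
  indep_off (inner setT [set x in t]) (block_event t).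
Proof.
move=> ut; apply: indep_off_prod => -[i j] /=.
apply: (@indep_off_spokes _ _ _ _ (fun b : bool => b%:R)) => //.
  by rewrite inE mem_tnth.
exact: tnth_notin_earlier.
Qed.

(** Solving can fail only if no packed tree succeeds internally, or if some outside vertex misses a
    residue class of some packed tree. Independence over disjoint trees bounds the first by
    [(1 - q)^M <= exp(-Mq)], and a union bound handles the second. *)
Lemma solve_prob_ge : (L <= #|T|)%N -> exists M : nat,
  (#|T| <= M * (L + L * (D * L)))%N /\
  1 - expR (- (M%:R * (p * expR (- (4 / p))) ^+ (sigma ^ 2)))
    - (#|T| * #|T| * sigma)%:R * (1 - p) ^+ m <= solve_prob G sigma 1 None p.
Proof.
move=> LT; have L_gt0 : (0 < L)%N by rewrite muln_gt0 m_gt0.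
have deg (u : T) : (#|[set w | adj u w]| <= D)%N.
  by apply: leq_trans degD; apply: (leq_bigmax u).
have [B [goodB disB TB]] := exists_packing (@adj_sym G) G_conn deg L_gt0 LT.
exists #|B|; split=> //; rewrite /solve_prob er_probE.
set s := enum (vpairs T); set q := (_ * _) ^+ _.
(* Disjoint trees have distinct first vertices. *)
have BT : (#|B| <= #|T|)%N.
  pose f t := tnth t (Ordinal L_gt0).
  rewrite -(card_in_imset (f := f) (D := B)) ?max_card // => t t' tB t'B ff.
  apply: contraTeq isT => /(disB _ _ tB t'B) dtt.
  have := @disjointFr _ _ _ (f t) dtt; rewrite !inE mem_tnth ff mem_tnth.
  by move=> /(_ isT).
pose bad := enum [pred x : L.-tuple T * T * 'I_sigma |
  (x.1.1 \in B) && (x.1.2 \notin x.1.1)].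
pose miss (x : L.-tuple T * T * 'I_sigma) E : R :=
  1 - (meets (outer_group x.1.1 x.1.2 x.2) E)%:R.
have miss0 r E : 0 <= \sum_(x <- r) miss x E.
  by apply: sumr_ge0 => x _; rewrite subr_ge0; case: meets.
have ev01 t E : 0 <= 1 - block_event t E <= 1.
  by rewrite block_eventE; case: [forall _, _]; rewrite ?subrr ?subr0 lexx ler01.
(* Pointwise comparison with the indicator of solving. On an unsolved configuration, either no tree
   succeeds and the product is 1, or some tree succeeds and a missed group makes the sum at least
   1. *)
apply: (@le_trans _ _ (bexp p s (fun E =>
    1 - \prod_(t <- enum B) (1 - block_event t E) - \sum_(x <- bad) miss x E))); last first.
  apply: ler_bexp => // E; rewrite -addrA -opprD; case: asboolP => [_|nS].
    rewrite gerBl addr_ge0 ?miss0 //; apply: prodr_ge0 => t _.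
    by case/andP: (ev01 t E).
  rewrite subr_le0; case: (pickP [pred t in B | block_event t E != 0]) => [t|none].
    case/andP=> tB; rewrite block_eventE; case: forallP => [mE _|_]; last by rewrite eqxx.
    have [ut ot] := goodB t tB.
    have [x xbad nm] : exists2 x, x \in bad & ~~ meets (outer_group x.1.1 x.1.2 x.2) E.
      apply: contrapT => nx; apply: nS.
      apply: (Solve_block sigma_gt0 G_conn (@adj_sym G) ut ot L_gt0) => [i j ji|v j vt].
        by have /forallP/(_ j)/implyP := mE i; apply.
      apply: contrapT => /negP nm; apply: nx; exists (t, v, j) => //.
      by rewrite mem_enum inE /= tB.
    rewrite (big_rem x) //= /miss (negPf nm) subr0 addrCA lerDl addr_ge0 ?miss0 //.
    by apply: prodr_ge0 => t' _; case/andP: (ev01 t' E).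
  suff -> : \prod_(t <- enum B) (1 - block_event t E) = 1 by rewrite lerDl miss0.
  apply: big1_seq => t /andP[_]; rewrite mem_enum => tB.
  by have := none t; rewrite /= tB => /negbFE/eqP ->; rewrite subr0.
rewrite !bexpB bexp_const bexp_sum; apply: lerB; first (rewrite lerD2l lerN2).
  rewrite (@bexp_prod _ _ _ _ _ _ (fun t => inner setT [set x in t])) ?enum_uniq //.
  - apply: (@le_trans _ _ (\prod_(t <- enum B) expR (- q))).
      rewrite big_seq [leRHS]big_seq; apply: ler_prod => t; rewrite mem_enum => tB.
      have [ut _] := goodB t tB; rewrite bexpB bexp_const.
      have := bexp_block_event ut; rewrite -/q -/s => qle.
      apply/andP; split; last first.
        by apply: le_trans (expR_ge1Dx _); rewrite lerD2l lerN2.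
      rewrite -(bexp_const p s 1) -bexpB -(bexp_const p s 0); apply: ler_bexp => // E.
      by case/andP: (ev01 t E).
    by rewrite big_enum /= prodr_const -expRM_natl mulrN.
  - move=> t; rewrite mem_enum => /goodB[ut _] e E eX; congr (1 - _).
    exact: indep_off_block_event ut _ _ eX.
  - by move=> t t'; rewrite !mem_enum => tB t'B tt; apply/disjoint_inner/disB.
apply: (@le_trans _ _ (\sum_(x <- bad) (1 - p) ^+ m)).
  rewrite big_seq [leRHS]big_seq; apply: ler_sum => -[[t v] j].
  rewrite mem_enum inE /= => /andP[tB vt]; have [ut _] := goodB t tB.
  rewrite /miss bexpB bexp_const bexp_meets ?enum_uniq //=; last first.
    by apply: spokes_vpairs; apply: contra vt => /imsetP[k _ ->]; apply: mem_tnth.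
  case/andP: q01 => q0 q1; rewrite subKr ler_wiXn2l ?(ltW q1) //.
  exact: card_outer_group.
rewrite big_const_seq count_predT iter_addr_0 -[leLHS]mulr_natl.
rewrite ler_wpM2r ?exprn_ge0 //; first by case/andP: q01.
rewrite ler_nat /bad -cardE.
apply: (@leq_trans #|setX (setX B [set: T]) [set: 'I_sigma]|).
  by apply/subset_leq_card/subsetP=> x; rewrite !inE => /andP[->].
by rewrite !cardsX !cardsT card_ord !leq_mul2r BT !orbT.
Qed.

End ManyBlocks.

(** * Numerical estimates *)

Section Estimates.
Variable R : realType.
Implicit Types (x p c : R).

Lemma bin_fact_le_exp n m : ('C(n, m) * m`! <= n ^ m)%N.
Proof.
rewrite bin_ffact; elim: m n => [|m IHm] [|n] //.
rewrite ffactSS expnS leq_mul2l /= (leq_trans (IHm n)) //.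
by case: (m) => // m'; rewrite leq_exp2r.
Qed.

Lemma exp_fact_le n : (n%:R : R) ^+ n <= n`!%:R * expR n%:R.
Proof.
case: n => [|n]; first by rewrite expr0 fact0 expR0 mulr1.
have f0 : 0 < n.+1`!%:R :> R by rewrite ltr0n fact_gt0.
rewrite mulrC -ler_pdivrMr //.
by apply: le_trans (expR_ge1Dxn n (ler0n R n.+1)); rewrite lerDr.
Qed.

(** This is the bound of the binomial by [(e n / m)^m], free of division so that [m = 0] is
    covered. *)
Lemma bin_le n m : ('C(n, m)%:R : R) * m%:R ^+ m <= n%:R ^+ m * expR m%:R.
Proof.
apply: (@le_trans _ _ ('C(n, m)%:R * (m`!%:R * expR m%:R))).
  by rewrite ler_wpM2l // exp_fact_le.
by rewrite mulrA ler_wpM2r ?expR_ge0 // -natrM -natrX ler_nat bin_fact_le_exp.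
Qed.

(** The value [c] solving [32 (D+1)^8 c e = e^(-2)]: it makes each of the [sigma h] factors of the
    people-edge term at most [e^(-2)]. *)
Definition lower_cst D : R := (32%:R * D.+1%:R ^+ 8 * expR 3)^-1.

Lemma lower_cst_gt0 D : 0 < lower_cst D.
Proof. by rewrite invr_gt0 !mulr_gt0 ?expR_gt0 ?exprn_gt0 ?ltr0n. Qed.

Lemma solve_prob_small (G : sgraph) D sigma p :
  (max_degree G <= D)%N -> (0 < sigma)%N -> 0 <= p <= 1 ->
  let x := ln #|{: G}|%:R in
  8 <= x -> sigma%:R <= x ->
  lower_cst D * sigma%:R ^+ 2 * (D.+1 ^ 8 * 2 ^ (4 * D))%:R * expR (2 * sigma%:R) <= x ->
  p <= lower_cst D * (sigma%:R ^+ 2 / x) ->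
  solve_prob G sigma 1 None p < 2^-1.
Proof.
move=> degD s0 p01; set N := #|{: G}|; set x := ln _ => /= x8 xs xK px.
case/andP: (p01) => p0 p1.
have x0 : 0 < x by apply: lt_le_trans x8.
have N0 : 0 < N%:R :> R.
  rewrite ltNge; apply/negP=> N0; move: x0; rewrite /x ln0 ?ltxx //.
have Nx : N%:R = expR x by rewrite /x lnK ?posrE.
have sR : 0 < sigma%:R :> R by rewrite ltr0n.
(* With this rounding, [x < sigma h <= 2x]. *)
set h := (Num.truncn (x / sigma%:R)).+1.
have /andP[h1 h2] : h.-1%:R <= x / sigma%:R < h%:R.
  by rewrite /= truncn_itv // divr_ge0 ?ltW.
rewrite ler_pdivlMr // in h1; rewrite ltr_pdivrMr // in h2.
rewrite mulrC in h1; rewrite mulrC in h2.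
have hS : h%:R = h.-1%:R + 1 :> R by rewrite natr1.
have hx : sigma%:R * h%:R <= 2 * x by rewrite hS mulrDr mulr1; lra.
have s1 : 1 <= sigma%:R :> R by rewrite ler1n.
have hN : (h.*2 < N)%N.
  rewrite -(ltr_nat R) Nx -muln2 natrM.
  have := expR_ge1Dxn 1 (ltW x0); rewrite (_ : 2`! = 2%N) // => Ex.
  apply: lt_le_trans Ex; rewrite expr2.
  have : h%:R <= sigma%:R * h%:R :> R by rewrite ler_peMl.
  have : 8 * x <= x * x by rewrite ler_wpM2r // ltW.
  lra.
apply: (le_lt_trans (solve_prob_le sigma degD p01 (ltn0Sn _) hN)).
rewrite -/N natrM mulrDr.
have eNx : expR (- (2 * (sigma%:R * h%:R))) <= expR (- x) / N%:R.
  by rewrite Nx -expRN -expRD ler_expR; lra.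
have E4 : expR (- x) < 4^-1.
  by rewrite expRN ltf_pV2 ?posrE ?expR_gt0 //; have := expR_ge1Dx x; lra.
set B := (D.+1 ^ 8)%N in xK; set e2 := expR (- (2 * (sigma%:R * h%:R))) in eNx.
have e2E : e2 = expR (- (2 * sigma%:R)) ^+ h by rewrite -expRM_natl /e2; congr expR; ring.
(* Each term is at most [e^(-2 sigma h) <= N^(-2)]. The factor [N] for the starting vertex leaves
   [1/N < 1/4] per term. *)
suff [T1 T2] : B%:R ^+ h * ((2 ^ (4 * h * D))%:R * p ^+ h) <= e2
   /\ B%:R ^+ h * ('C((4 * h) ^ 2, sigma * h)%:R * p ^+ (sigma * h)) <= e2.
  have T t t' : t' <= e2 -> t = N%:R * t' -> t < 4^-1.
    move=> H ->; apply: le_lt_trans E4.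
    by rewrite -ler_pdivlMl // mulrC; apply: (le_trans H).
  have H1 := T _ _ T1 erefl; have H2 := T _ _ T2 erefl.
  have -> : (D.+1 ^ (8 * h))%:R = B%:R ^+ h :> R by rewrite expnM natrX.
  rewrite -!mulrA [ltRHS](_ : _ = 4^-1 + 4^-1); last by field.
  exact: ltrD.
have cs := lower_cst_gt0 D; set c := lower_cst D in cs px xK.
have B0 : 0 < B%:R :> R by rewrite ltr0n expn_gt0.
split.
  (* Double-edge term: it is an [h]-th power, and the hypothesis [xK] brings its base below
     [e^(-2 sigma)]. *)
  have -> : (2 ^ (4 * h * D))%:R = (2 ^ (4 * D))%:R ^+ h :> R.
    by rewrite mulnAC expnM natrX.
  rewrite e2E -!exprMn.
  rewrite lerXn2r ?nnegrE ?mulr_ge0 ?expR_ge0 //.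
  rewrite expRN -[leRHS]mulr1 -ler_pdivrMl ?invr_gt0 ?expR_gt0 // invrK.
  rewrite -(ler_pM2r x0) mul1r; apply: le_trans xK.
  rewrite mulrA [leRHS](_ : _ = expR (2 * sigma%:R) * (B * 2 ^ (4 * D))%:R *
    (c * sigma%:R ^+ 2)); last by ring.
  rewrite natrM -!mulrA ler_wpM2l ?expR_ge0 // ler_wpM2l // ler_wpM2l //.
  by rewrite -ler_pdivlMr // mulrA in px *.
have sh0 : (0 < sigma * h)%N by rewrite muln_gt0 s0.
have shR : 0 < (sigma * h)%:R :> R by rewrite ltr0n.
(* Raising the exponent of [B] from [h] to [sigma h] makes the whole term a power with exponent
   [sigma h], so the constant does not depend on [sigma]. *)
apply: (@le_trans _ _ (B%:R ^+ (sigma * h) * ('C((4 * h) ^ 2, sigma * h)%:R * p ^+ (sigma * h)))).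
  rewrite ler_wpM2r ?mulr_ge0 ?exprn_ge0 // ler_weXn2l ?ler1n ?expn_gt0 //.
  by rewrite leq_pmull.
have -> : e2 = expR (- 2) ^+ (sigma * h).
  by rewrite -expRM_natl /e2 natrM; congr expR; ring.
rewrite -(ler_pM2r (_ : 0 < (sigma * h)%:R ^+ (sigma * h) :> R)) ?exprn_gt0 //.
rewrite [leLHS](_ : _ = (B%:R * p) ^+ (sigma * h) *
   ('C((4 * h) ^ 2, sigma * h)%:R * (sigma * h)%:R ^+ (sigma * h))); last first.
  by rewrite exprMn -!mulrA [X in _ * X = _]mulrCA.
apply: le_trans (ler_wpM2l _ (bin_le _ _)) _; first by rewrite exprn_ge0 ?mulr_ge0.
have -> : expR (sigma * h)%:R = expR 1 ^+ (sigma * h) :> R by rewrite -expRM_natl mulr1.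
rewrite -!exprMn lerXn2r ?nnegrE ?mulr_ge0 ?expR_ge0 //.
have hp : h%:R * p <= 2 * c * sigma%:R.
  rewrite -(ler_pM2r sR) -(ler_pM2r x0).
  move: px; rewrite mulrA ler_pdivlMr // => px.
  rewrite [leLHS](_ : _ = (sigma%:R * h%:R) * (p * x)); last by ring.
  rewrite [leRHS](_ : _ = (2 * x) * (c * sigma%:R ^+ 2)); last by ring.
  by apply: ler_pM => //; rewrite mulr_ge0 // ltW.
have cE : 32 * B%:R * c * expR 1 = expR (- 2).
  rewrite /c /lower_cst natrX (_ : 3 = 2 + 1 :> R); last by ring.
  rewrite expRD expRN; field.
  by rewrite nat1r pnatr_eq0 !gt_eqF ?expR_gt0.
rewrite natrX natrM [leLHS](_ : _ = 16 * B%:R * expR 1 * h%:R * (h%:R * p)); last by ring.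
apply: le_trans (ler_wpM2l _ hp) _; first by rewrite !mulr_ge0 ?expR_ge0.
by rewrite -cE natrM le_eqVlt; apply/orP; left; apply/eqP; ring.
Qed.
End Estimates.

(** * Solving is likely above the threshold *)

Section LargeProbability.
Variable R : realType.
Implicit Types (x p c : R).

(** The Taylor term of degree [n + 1] has one spare power of [x], which absorbs the constants. *)
Lemma monomial_le_expR n (K : nat) x : (K * 2 ^ n.+1 * n.+1`!)%:R <= x ->
  K%:R * x ^+ n <= expR (x / 2).
Proof.
move=> Kx; have x0 : 0 <= x by apply: le_trans Kx.
apply: le_trans (_ : (x / 2) ^+ n.+1 / n.+1`!%:R <= _); last first.
  by apply: le_trans (expR_ge1Dxn n (_ : 0 <= x / 2)); rewrite ?lerDr ?divr_ge0.
rewrite ler_pdivlMr ?ltr0n ?fact_gt0 // expr_div_n ler_pdivlMr ?exprn_gt0 //.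
rewrite [leRHS]exprS [leLHS](_ : _ = (K * 2 ^ n.+1 * n.+1`!)%:R * x ^+ n).
  by rewrite ler_wpM2r ?exprn_ge0.
by rewrite !natrM natrX; ring.
Qed.

Lemma solve_prob_large (G : sgraph) D sigma p :
  connected_graph G -> (max_degree G <= D)%N -> (0 < sigma)%N -> p <= 1 ->
  let x := ln #|{: G}|%:R in
  let n := (sigma ^ 2 + 4)%N in
  let K := (4 * (2 * sigma + 4 * D * sigma ^ 2))%N in
  1 <= x -> 4 * sigma%:R <= x -> (K * 2 ^ n.+1 * n.+1`!)%:R <= x ->
  16 * (sigma%:R ^+ 2 / x) <= p ->
  2^-1 < solve_prob G sigma 1 None p.
Proof.
move=> Gc degD s0 p1; set N := #|{: G}|; set x := ln _.
set n := (_ + _)%N; set K := (4 * _)%N => /= x1 sx Kx px.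
have x0 : 0 < x by apply: lt_le_trans x1.
have N0 : 0 < N%:R :> R.
  by rewrite ltNge; apply/negP=> N0; move: x0; rewrite /x ln0 ?ltxx.
have Nx : N%:R = expR x by rewrite /x lnK ?posrE.
have s1 : 1 <= sigma%:R :> R by rewrite ler1n.
have s2 : 1 <= sigma%:R ^+ 2 :> R by rewrite exprn_ege1.
have xp : 16 * sigma%:R ^+ 2 <= p * x by rewrite -ler_pdivrMr // -mulrA.
have p0 : 0 < p by rewrite -(pmulr_lgt0 _ x0); apply: lt_le_trans xp; lra.
(* Then [x^2 < m <= 2x^2]. This gives [m p >= 16 x], enough to beat the union bound over outside
   vertices, while the tree size stays polynomial in [x]. *)
set m := (Num.truncn (x ^+ 2)).+1.
have /andP[m1 m2] : m.-1%:R <= x ^+ 2 < m%:R.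
  by rewrite /= truncn_itv // exprn_ge0 // ltW.
have xx1 : 1 <= x ^+ 2 by rewrite exprn_ege1.
have mS : m%:R = m.-1%:R + 1 :> R by rewrite natr1.
have mx : m%:R <= 2 * x ^+ 2 by rewrite mS; lra.
have x24 : x ^+ 2 <= x ^+ 4 by rewrite ler_weXn2l.
have LK : (m * sigma + m * sigma * (D * (m * sigma)))%:R * 4 <= K%:R * x ^+ 4.
  have H1 : (m * sigma)%:R <= 2 * sigma%:R * x ^+ 2.
    by rewrite natrM mulrAC ler_wpM2r.
  have H2 : (m * sigma)%:R * (m * sigma)%:R <= (2 * sigma%:R * x ^+ 2) * (2 * sigma%:R * x ^+ 2).
    by apply: ler_pM.
  rewrite natrD [(_ * (D * _))%:R](_ : _ = D%:R * ((m * sigma)%:R * (m * sigma)%:R)); last first.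
    by rewrite !natrM; ring.
  have -> : K%:R = (2 * sigma%:R + 4 * D%:R * sigma%:R ^+ 2) * 4 :> R.
    by rewrite /K natrM natrD !natrM; ring.
  rewrite mulrAC ler_pM2r // mulrDl lerD //.
    by apply: le_trans H1 _; rewrite ler_wpM2l ?mulr_ge0.
  apply: le_trans (ler_wpM2l (ler0n R D) H2) _; rewrite le_eqVlt.
  by apply/orP; left; apply/eqP; ring.
have K_ge : 4 * (2 * sigma%:R) <= K%:R :> R.
  by rewrite -!natrM ler_nat /K leq_mul2l /= leq_addr.
have Kexp := monomial_le_expR Kx.
have xn4 : x ^+ 4 <= x ^+ n by rewrite ler_weXn2l // leq_addl.
have expx : expR x = expR (x / 2) * expR (x / 4) * expR (x / 4).
  by rewrite -!expRD; congr expR; field.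
have LN : (m * sigma <= N)%N.
  rewrite -(ler_nat R) Nx; apply: (@le_trans _ _ (K%:R * x ^+ 4)).
    apply: le_trans LK; rewrite mulr_natr.
    apply: le_trans (_ : (m * sigma)%:R *+ 4 <= _).
      by rewrite -mulrnA ler_nat leq_pmulr.
    by rewrite lerMn2r ler_nat leq_addr orbT.
  apply: (@le_trans _ _ (expR (x / 2))).
    by apply: le_trans Kexp; rewrite ler_wpM2l.
  by rewrite ler_expR; lra.
have [M [NM]] := solve_prob_ge Gc degD p0 p1 s0 (ltn0Sn _) LN.
apply: lt_le_trans; rewrite -/N.
(* It suffices that [M q >= 4]. From [1/x <= p] and [16 sigma^2 <= p x] comes
   [q >= x^(-sigma^2) e^(-x/4)]; the packing bound, with the spare factor 4 in [K], gives
   [M K x^4 >= 4N]; and [K x^n <= e^(x/2)]. *)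
have H1 : expR (- (M%:R * (p * expR (- (4 / p))) ^+ (sigma ^ 2))) <= 5^-1.
  rewrite expRN lef_pV2 ?posrE ?expR_gt0 //.
  have q_ge : (x ^+ (sigma ^ 2))^-1 * expR (- (x / 4)) <= (p * expR (- (4 / p))) ^+ (sigma ^ 2).
    rewrite exprMn; apply: ler_pM; rewrite ?invr_ge0 ?exprn_ge0 ?expR_ge0 ?(ltW x0) //.
      rewrite -exprVn lerXn2r ?nnegrE ?invr_ge0 ?(ltW x0) ?(ltW p0) //.
      rewrite -(ler_pM2r x0) mulVf ?gt_eqF //; lra.
    rewrite -expRM_natl ler_expR natrX mulrN lerN2 mulrA ler_pdivrMr //; lra.
  have x20 : 0 < x ^+ (sigma ^ 2) by rewrite exprn_gt0.
  apply: le_trans (expR_ge1Dx _); rewrite (_ : 5 = 1 + 4); last by ring.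
  rewrite lerD2l; apply: le_trans (ler_wpM2l (ler0n R M) q_ge).
  rewrite mulrCA ler_pdivlMl // -(ler_pM2r (expR_gt0 x)).
  have S1 : expR x * 4 <= M%:R * (K%:R * x ^+ 4).
    apply: le_trans (ler_wpM2l (ler0n R M) LK).
    by rewrite -Nx mulrA ler_pM2r -?natrM ?ler_nat.
  apply: (@le_trans _ _ (M%:R * expR (x / 2))); last first.
    by rewrite -mulrA -expRD ler_wpM2l // ler_expR; lra.
  apply: le_trans (ler_wpM2l (ler0n R M) Kexp).
  rewrite /n exprD [leLHS](_ : _ = (expR x * 4) * x ^+ (sigma ^ 2)); last by ring.
  rewrite [leRHS](_ : _ = (M%:R * (K%:R * x ^+ 4)) * x ^+ (sigma ^ 2)); last by ring.
  by rewrite ler_wpM2r // ltW.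
have H2 : (N * N * sigma)%:R * (1 - p) ^+ m <= 4^-1.
  have pm : 16 * x <= m%:R * p.
    apply: (@le_trans _ _ (x ^+ 2 * p)); last by rewrite ler_wpM2r ?ltW.
    rewrite [leRHS](_ : _ = p * x * x); last by ring.
    by rewrite ler_pM2r //; apply: le_trans xp; lra.
  apply: (@le_trans _ _ (expR x * expR x * sigma%:R * expR (- (16 * x)))).
    rewrite !natrM -Nx ler_wpM2l ?mulr_ge0 //.
    apply: (@le_trans _ _ (expR (- p) ^+ m)).
      by rewrite lerXn2r ?nnegrE ?expR_ge0 ?subr_ge0 // expR_ge1Dx.
    by rewrite -expRM_natl ler_expR mulrN lerN2.
  have -> : expR x * expR x * sigma%:R * expR (- (16 * x)) = sigma%:R * expR (- (14 * x)).
    rewrite mulrAC [_ * sigma%:R]mulrC -!expRD; congr (_ * expR _); ring.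
  rewrite expRN ler_pdivrMr ?expR_gt0 //.
  by have := expR_ge1Dx (14 * x); lra.
(* The margin is [1 - 1/5 - 1/4 > 1/2]. *)
by move: H1 H2; move: (expR _) (_ * (1 - p) ^+ m) => a b; clear; lra.
Qed.
End LargeProbability.

(** The solving probability is a polynomial in [p], so the intermediate value theorem applies. *)
Lemma critical_exists (R : realType) (G : sgraph) sigma tau theta :
  solve_prob G sigma tau theta (0 : R) <= 2^-1 <= solve_prob G sigma tau theta (1 : R) ->
  exists p : R, is_critical G sigma tau theta p.
Proof.
pose A E := Solve (@adj G) (edge_rel E) sigma tau theta.
pose P : {poly R} := \sum_(E : {set {set G}} | (E \subset vpairs G) && `[< A E >])
  \prod_(e in vpairs G) (if e \in E then 'X else 1 - 'X).
have PE p : P.[p] = solve_prob G sigma tau theta p.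
  rewrite horner_sum; apply: eq_bigr => E _; rewrite horner_prod.
  by apply: eq_bigr => e _; case: ifP; rewrite !hornerE.
rewrite -!PE => /andP[P0 P1].
have [|p p01] := @poly_ivt R (P - (2^-1)%:P) 0 1 ler01.
  by rewrite !hornerE subr_le0 subr_ge0 P0.
by rewrite /root !hornerE subr_eq0 PE => /eqP; exists p.
Qed.

(** * Bounds on the critical probability *)

Local Open Scope classical_set_scope.

Theorem theorem3 (R : realType) (D : nat) :
  exists c1 c2 : R, 0 < c1 /\ 0 < c2 /\
    forall G : nat -> sgraph,
      (forall n, connected_graph (G n)) ->
      (forall n, (max_degree (G n) <= D)%N) ->
      ((fun n => #|{: G n}|) @ \oo --> \oo) ->
      forall sigma : nat, (1 <= sigma)%N ->
        exists N0 : nat, forall n : nat, (N0 <= #|{: G n}|)%N ->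
          (exists pc : R, is_critical (G n) sigma 1 None pc) /\
          (forall pc : R, is_critical (G n) sigma 1 None pc ->
             c1 * (sigma%:R ^+ 2 / ln (#|{: G n}|%:R)) <= pc /\
             pc <= c2 * (sigma%:R ^+ 2 / ln (#|{: G n}|%:R))).
Proof.
exists (lower_cst R D), 16; split; first exact: lower_cst_gt0; split=> // G Gc degD _ sigma s0.
pose a1 : R := lower_cst R D * sigma%:R ^+ 2 * (D.+1 ^ 8 * 2 ^ (4 * D))%:R * expR (2 * sigma%:R).
pose n := (sigma ^ 2 + 4)%N.
pose a2 : R := (4 * (2 * sigma + 4 * D * sigma ^ 2) * 2 ^ n.+1 * n.+1`!)%:R.
(* The sum dominates every lower bound on [x] demanded by the two estimates; its last summand also
   makes [16 sigma^2 / x <= 1], so that the large-probability estimate applies at [p = 1]. *)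
pose X : R := 8 + a1 + a2 + 16 * sigma%:R ^+ 2.
have s1 : 1 <= sigma%:R :> R by rewrite ler1n.
have s2 : sigma%:R <= sigma%:R ^+ 2 :> R by rewrite expr2 ler_peMl.
have a10 : 0 <= a1 by rewrite !mulr_ge0 ?expR_ge0 ?exprn_ge0 // ltW // lower_cst_gt0.
have a20 : 0 <= a2 by [].
exists (Num.bound (expR X)) => k Nk.
set x := ln _; have Xx : X <= x.
  have EX : expR X < #|{: G k}|%:R.
    apply: lt_le_trans (archi_boundP (expR_ge0 X)) _.
    by rewrite ler_nat.
  rewrite -(expRK X) ler_ln ?posrE ?expR_gt0 //; first exact: ltW.
  exact: lt_trans (expR_gt0 X) EX.
have x0 : 0 < x by rewrite /X in Xx; lra.
have small p : 0 <= p <= 1 -> p <= lower_cst R D * (sigma%:R ^+ 2 / x) ->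
    solve_prob (G k) sigma 1 None p < 2^-1.
  move=> p01; apply: (solve_prob_small (degD k) s0 p01); rewrite -/x -?/a1;
    rewrite /X in Xx; lra.
have large p : p <= 1 -> 16 * (sigma%:R ^+ 2 / x) <= p ->
    2^-1 < solve_prob (G k) sigma 1 None p.
  move=> p1; apply: (solve_prob_large (Gc k) (degD k) s0 p1); rewrite -/x -/n -?/a2;
    rewrite /X in Xx; lra.
split.
  apply: critical_exists; apply/andP; split; apply/ltW.
    apply: small; first by rewrite lexx ler01.
    by rewrite mulr_ge0 ?divr_ge0 ?exprn_ge0 ?(ltW x0) // ltW // lower_cst_gt0.
  apply: large => //; rewrite mulrA ler_pdivrMr // mul1r; rewrite /X in Xx; lra.
move=> p [p01 pE]; have /andP[_ p1] := p01.
split; rewrite leNgt; apply/negP=> lt_p.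
  by have := small p p01 (ltW lt_p); rewrite pE ltxx.
by have := large p p1 (ltW lt_p); rewrite pE ltxx.
Qed.
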